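(* Let $\phi:\mathbb{R}\to\mathbb{R}$ be continuous and $1$-periodic, $T>0$, and let $\Gamma\subset (C([0,T],\mathbb{R}),\|\cdot\|_\infty)$ be a closed subspace (closed subset) consisting of increasing (injective) functions. Let $\mu_1,\mu_2$ be Borel probability measures on $\Gamma$, let $\gamma_1\sim\mu_1$, $\gamma_2\sim\mu_2$, and let $\delta_{0,T}:\gamma\mapsto(\gamma(0),\gamma(T))\in\mathbb{R}^2$. If the push-forward measures $(\delta_{0,T})_\star\mu_1$ and $(\delta_{0,T})_\star\mu_2$ are equal, then $$F(\phi\circ\gamma_1)=F(\phi\circ\gamma_2).$$
   Context: **Persistence diagram.** For a continuous function $h:\mathbb{X}\to\mathbb{R}$ on a compact interval $\mathbb{X}$, let $\mathbb{X}_t=h^{-1}((-\infty,t])$ and define a persistence module by $V_t=H_0(\mathbb{X}_t)$ (singular homology with coefficients in a fixed field) if $t<\max h$ and $V_t=0$ if $t\ge\max h$; for $s\le t<\max h$ the map $V_s\to V_t$ is induced by inclusion, and for $t\ge \max h$ it is zero. All ranks $r(s,t)=\mathrm{rank}(V_s\to V_t)$, $s<t$, are finite. The persistence diagram $D(h)$ is the multiset consisting of every diagonal point $(r,r)$ with infinite multiplicity together with the unique locally finite multiset of points in $\{(b,d):b<d\}$ such that for all $a<b<c<d$ for which no point lies on the boundary of $[a,b]\times[c,d]$, the number of points (with multiplicity) in $[a,b]\times[c,d]$ equals $r(b,c)-r(a,c)-r(b,d)+r(a,d)$. **Kernel and functionals.** Let $\epsilon>0$, $p>1$ and let $(\mathbb{T},d)$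 be a Euclidean space. A kernel is a map $k$ which associates to each $x\in\mathbb{R}^2$ a function $k(x):\mathbb{T}\to\mathbb{R}$; $\|\cdot\|_\infty$ is the sup norm for functions and the max norm on $\mathbb{R}^2$. It is assumed that: there is a compact $K_0\subset\mathbb{T}$ with $k(x)=0$ on $\mathbb{T}\setminus K_0$ for all $x$; there is $L>0$ with $|k(x)(t)-k(x)(s)|\le L\,d(s,t)$ for all $x\in\mathbb{R}^2$, $s,t\in\mathbb{T}$; there is $L_k>0$ with $\|k(x)-k(x')\|_\infty\le L_k\|x-x'\|_\infty$ for all $x,x'$; there is $C\ge0$ with $\|k(x)\|_\infty\le C$ for all $x$ on the diagonal $\{(r,r):r\in\mathbb{R}\}$. With $w_\epsilon(b,d)=\max(d-b-\epsilon,0)$, for a continuous function $S$ on $[0,T]$, $$\overline{\rho}(S)(t)=\frac{\sum_{x\in D(S)}w_\epsilon(x)^p\,k(x)(t)}{\sum_{x\in D(S)}w_\epsilon(x)^p}$$ if the denominator is positive and $\overline{\rho}(S)=0$ otherwise. For a random continuous function $S$, the signature is $F(S)(t)=\mathbb{E}[\overline{\rho}(S)(t)]$, $t\in\mathbb{T}$. *)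

(* Defs.v *)
From HB Require Import structures.
From mathcomp Require Import all_boot all_order all_algebra.
From mathcomp Require Import all_classical all_reals all_analysis.
From mathcomp.multinomials Require Import freeg.
Import Order.TTheory GRing.Theory Num.Theory.
Import numFieldNormedType.Exports.

Set Implicit Arguments.
Unset Strict Implicit.
Unset Printing Implicit Defensive.

Local Open Scope classical_set_scope.
Local Open Scope ring_scope.

Section Interval.
Context {R : realType}.

Definition segment (a b : R) : set R := `[a, b]%classic.

Lemma segment_left_subproof (a b : R) : a <= b -> a \in segment a b.
Proof. by move=> ab; apply/mem_set; rewrite /segment /= in_itv/= lexx. Qed.

Lemma segment_right_subproof (a b : R) : a <= b -> b \in segment a b.
Proof. by move=> ab; apply/mem_set; rewrite /segment /= in_itv/= lexx andbT. Qed.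

Definition segment_left (a b : R) (ab : a <= b) : segment a b :=
  exist _ a (segment_left_subproof ab).

Definition segment_right (a b : R) (ab : a <= b) : segment a b :=
  exist _ b (segment_right_subproof ab).

End Interval.

(* C(X, R) with the topology of uniform convergence, which for compact X is the
   topology of the sup norm. *)
Definition cont_space (X : topologicalType) (R : realType) : Type :=
  continuousType X R.

HB.instance Definition _ (X : topologicalType) (R : realType) :=
  Choice.on (cont_space X R).
HB.instance Definition _ (X : topologicalType) (R : realType) :=
  Uniform.copy (cont_space X R)
    (initial_topology (fun f : continuousType X R => (f : {uniform X -> R}))).

(* The library only has nonempty measurable types, whence the argument A0. *)
Definition borel_subspace (X : topologicalType) (A : set X) (A0 : A !=set0)
  : Type := set_type A.

Section BorelSubspace.
Context (X : topologicalType) (A : set X) (A0 : A !=set0).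

HB.instance Definition _ := Topological.on (borel_subspace A0).

Lemma borel_subspace_inhabited : inhabited (borel_subspace A0).
Proof. by have [x Ax] := A0; exact: inhabits (exist _ x (mem_set Ax)). Qed.

HB.instance Definition _ :=
  isPointed.Build (borel_subspace A0) (inhabited_witness borel_subspace_inhabited).

Lemma borel_subspace_measurableC :
  setC_closed <<s @open (borel_subspace A0) >>.
Proof. by move=> B mB; rewrite -setTD; exact: sigma_algebraCD. Qed.

HB.instance Definition _ := @isMeasurable.Build
  (sigma_display (@open (borel_subspace A0))) (borel_subspace A0)
  <<s @open (borel_subspace A0) >> (@sigma_algebra0 _ setT _)
  borel_subspace_measurableC (@sigma_algebra_bigcup _ setT _).

End BorelSubspace.

Section SingularHomology.
Context (R : realType) (K : fieldType) (X : topologicalType).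
Implicit Types A B : set X.

Definition simplex1 : Type := continuousType (segment (0 : R) 1) X.
HB.instance Definition _ := Choice.on simplex1.

Definition boundary : {freeg simplex1 / K} -> {freeg X / K} :=
  fglift (fun s : simplex1 =>
    (<< s (segment_right ler01) >> - << s (segment_left ler01) >>
      : {freeg X / K})).

(* The singular chains of a subspace A of X are the chains of X all of whose
   simplices lie in A; 0-simplices are identified with points. *)
Definition chain0 A : set {freeg X / K} :=
  [set c | forall x, x \in dom c -> A x].

Definition chain1 A : set {freeg simplex1 / K} :=
  [set c | forall s : simplex1, s \in dom c -> range s `<=` A].

Definition boundary0 A : set {freeg X / K} := boundary @` chain1 A.

(* H_0(A) = chain0 A / boundary0 A. For A included in B, the classes in H_0(B)
   of m 0-cycles of A are linearly independent iff only the trivial linear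
   combination of these cycles is a boundary in B. *)
Definition H0_image_free A B (m : nat) (c : 'I_m -> {freeg X / K}) : Prop :=
  (forall i, chain0 A (c i)) /\
  (forall a : 'I_m -> K,
     boundary0 B (\sum_(i < m) a i *: c i) -> forall i, a i = 0).

Definition H0_rank_ge A B (m : nat) : Prop :=
  exists c : 'I_m -> {freeg X / K}, H0_image_free A B c.

(* Rank of H_0(A) -> H_0(B), as the largest size of a linearly independent
   family in the image; by convention 0 if there is no largest size. *)
Definition H0_rank A B : nat :=
  xget 0%N [set m | H0_rank_ge A B m /\
                    forall m', H0_rank_ge A B m' -> (m' <= m)%N].

End SingularHomology.

Section PersistenceDiagram.
Context (R : realType) (K : fieldType) (X : topologicalType).
Implicit Types h : X -> R.

Definition sublevel h (t : R) : set X := [set x | h x <= t].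

Definition pers_rank h (s t : R) : nat :=
  if t < sup (range h) then H0_rank R K (sublevel h s) (sublevel h t) else 0%N.

Definition rect (a b c d : R) : set (R * R) := `[a, b]%classic `*` `[c, d]%classic.

Definition rect_boundary (a b c d : R) : set (R * R) :=
  rect a b c d `\` (`]a, b[%classic `*` `]c, d[%classic).

Definition halfplane : set (R * R) := [set x | x.1 < x.2].

Definition is_offdiagonal_diagram h (m : R * R -> nat) : Prop :=
  [/\ forall x, m x != 0%N -> halfplane x,
      forall x, halfplane x ->
        exists2 U, nbhs x U & finite_set (U `&` [set y | m y != 0%N]) &
      forall a b c d, a < b -> b < c -> c < d ->
        (forall x, rect_boundary a b c d x -> m x = 0%N) ->
        ((\big[addn/0%N]_(x \in rect a b c d) m x)%:Z =
          (pers_rank h b c)%:Z - (pers_rank h a c)%:Z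
          - (pers_rank h b d)%:Z + (pers_rank h a d)%:Z)%R].

(* The diagram as a multiset: a point is mapped to its multiplicity. *)
Definition diagram h (x : R * R) : \bar R :=
  if x.1 == x.2 then +oo%E
  else (xget (fun=> 0%N) (is_offdiagonal_diagram h) x)%:R%:E.

(* Sum of f over the points of D(h), counted with multiplicity. As +oo * 0 = 0
   in \bar R, the diagonal contributes nothing when f vanishes on it. *)
Definition diagram_sum h (f : R * R -> R) : R :=
  fine (\sum_(x \in [set: R * R]) (diagram h x * (f x)%:E))%E.

End PersistenceDiagram.

Section Signature.
Context (R : realType) (K : fieldType) (n : nat).
Implicit Types k : R * R -> 'rV[R]_n -> R.

Definition euclidean_dist (s t : 'rV[R]_n) : R :=
  Num.sqrt (\sum_(i < n) (s ord0 i - t ord0 i) ^+ 2).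

Definition sup_norm (f : 'rV[R]_n -> R) : \bar R :=
  ereal_sup (range (fun t => `|f t|%:E)).

(* The library norm on R * R is the max norm. *)
Record is_kernel k : Prop := IsKernel {
  kernel_support : exists2 K0 : set 'rV[R]_n,
    compact K0 & forall x t, ~ K0 t -> k x t = 0 ;
  kernel_lipschitz_in : exists2 L : R,
    0 < L & forall x s t, `|k x t - k x s| <= L * euclidean_dist s t ;
  kernel_lipschitz : exists2 Lk : R,
    0 < Lk & forall x x', (sup_norm (k x \- k x')%R <= (Lk * `|x - x'|)%:E)%E ;
  kernel_diagonal : exists2 C : R,
    0 <= C & forall r, (sup_norm (k (r, r)) <= C%:E)%E
}.

Definition weight (eps : R) (x : R * R) : R := Num.max (x.2 - x.1 - eps) 0.

Definition rho_bar (eps p : R) k (X : topologicalType) (S : X -> R)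
    (t : 'rV[R]_n) : R :=
  let den := diagram_sum K S (fun x => weight eps x `^ p) in
  if 0 < den
  then diagram_sum K S (fun x => weight eps x `^ p * k x t) / den
  else 0.

Definition signature (eps p : R) k (X : topologicalType)
    (d : measure_display) (Omega : measurableType d) (P : probability Omega R)
    (S : Omega -> X -> R) (t : 'rV[R]_n) : \bar R :=
  ('E_P[fun w => rho_bar eps p k (S w) t])%E.

End Signature.

(* Main.v *)
From HB Require Import structures.
Require Import Defs.
From mathcomp Require Import all_boot all_order all_algebra.
From mathcomp Require Import all_classical all_reals all_analysis.
From mathcomp Require Import measurable_realfun.
From mathcomp.multinomials Require Import freeg.
From mathcomp Require Import lra zify.
Import Order.TTheory GRing.Theory Num.Theory.
Import numFieldNormedType.Exports.

(** The rank of H_0 of a sublevel set of [phi \o gamma] into a larger one is the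
    number of components of {phi <= t} in [gamma 0, gamma T] that meet
    {phi <= s}, because [gamma] is an increasing homeomorphism onto this
    interval.  So the diagram, and hence [rho_bar], depends on [gamma] only
    through its endpoints, and both signatures are integrals of one function of
    the endpoints against the common law of the endpoints.

    The change of variables needs this function to be Borel.  The rank is at
    least m when m points of {phi <= s} are separated by points of {phi > t};
    the separating points can be taken rational, so this is a Borel condition on
    the endpoints.  A sum over the diagram is a limit of Riemann sums whose
    weights are alternating sums of ranks.  This limit is identified with the
    sum over the diagram by proving that the diagram exists: the rank is right
    continuous in both arguments, and its alternating sums are natural numbers,
    so that over a half-open rectangle they count finitely many atoms. *)

Set Implicit Arguments.
Unset Strict Implicit.
Unset Printing Implicit Defensive.

Local Open Scope classical_set_scope.
Local Open Scope ring_scope.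

(** * Separated points of a sublevel set *)

Section Separation.
Context {R : realType} (h : R -> R).
Implicit Types (a b s t x y z : R) (m : nat) (xs : seq R).

(** For [x] and [y] in [{h <= t}] this says that they lie in different components of that set. Both
    orders of [x] and [y] are allowed, which makes the relation symmetric. *)
Definition sep t x y : bool :=
  `[< exists2 z, (x <= z <= y) || (y <= z <= x) & t < h z >].

Lemma sep_sym t : symmetric (sep t).
Proof.
by move=> x y; rewrite /sep; apply/asbool_equiv_eq; split=> -[z zP tz];
  exists z => //; rewrite orbC.
Qed.

Lemma sep_irr t x : h x <= t -> sep t x x = false.
Proof.
move=> xt; apply/asboolP => -[z]; rewrite orbb => /andP[xz zx].
by have -> : z = x; [apply/le_anti/andP|rewrite ltNge xt].
Qed.

(** Contrapositive of the transitivity of not being separated: a separating point between [x] and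
    [z] lies between [x] and [y] or between [y] and [z]. *)
Lemma sep_trans t x y z : sep t x z -> sep t x y || sep t y z.
Proof.
move=> /asboolP[u xuz tu].
have : (x <= u <= y) || (y <= u <= x) || ((y <= u <= z) || (z <= u <= y)).
  by case: (leP u y) => uy; case: (leP y u) => yu //=; lra.
by case/orP => ?; apply/orP; [left|right]; apply/asboolP; exists u.
Qed.

Lemma sep_le t t' x y : t <= t' -> sep t' x y -> sep t x y.
Proof.
by move=> tt' /asboolP[z xzy tz]; apply/asboolP; exists z => //; apply: le_lt_trans tz.
Qed.

Lemma sep_congr t x y x' y' : ~~ sep t x x' -> ~~ sep t y y' ->
  sep t x y -> sep t x' y'.
Proof.
move=> xx' yy' /(sep_trans x')/orP[|]; first by rewrite (negbTE xx').
by move=> /(sep_trans y')/orP[//|]; rewrite sep_sym (negbTE yy').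
Qed.

(** For [s <= t], the points represent distinct components of [{h <= t}] in [[a, b]] that meet
    [{h <= s}]. *)
Definition comp_ge a b s t m : Prop := exists xs : seq R,
  [/\ size xs = m, all (fun x => (a <= x <= b) && (h x <= s)) xs
    & pairwise (sep t) xs].

Lemma comp_ge0 a b s t : comp_ge a b s t 0.
Proof. by exists [::]. Qed.

Lemma comp_ge_le a b s t m m' : (m' <= m)%N ->
  comp_ge a b s t m -> comp_ge a b s t m'.
Proof.
move=> m'm [xs [sz /allP xsP ps]]; exists (take m' xs); split.
- by rewrite size_takel// sz.
- by apply/allP => x /mem_take/xsP.
- exact: subseq_pairwise (take_subseq _ _) ps.
Qed.

(** Points of [{h <= s}] from left to right, with a point of [{h > t}] between consecutive ones.
    Nothing is asked after the last point, whence the case [m' = 0]. *)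
Fixpoint chain s t m a b : Prop :=
  match m with
  | 0 => True
  | m'.+1 => exists x, [/\ a <= x <= b, h x <= s &
      m' = 0%N \/ exists y, [/\ x <= y <= b, t < h y & chain s t m' y b]]
  end.

Lemma pairwise_perm (T : eqType) (r : rel T) (s1 s2 : seq T) : symmetric r ->
  perm_eq s1 s2 -> pairwise r s1 -> pairwise r s2.
Proof.
move=> rsym; apply: (catCA_perm_ind (P := fun l : seq T => pairwise r l)) => u v w.
rewrite !pairwise_cat !allrel_catr => /and3P[/andP[uv uw] pu /and3P[vw pv pw]].
rewrite uw vw pu pv pw !andbT /= allrelC.
by rewrite (eq_allrel (r' := r)) ?uv// => x y; rewrite rsym.
Qed.

(** After sorting, separating consecutive points is enough: all that follows [y] in a chain lies to
    its right, so [y] separates [x] from every later point at once. *)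
Lemma comp_ge_chain a b s t m : comp_ge a b s t m <-> chain s t m a b.
Proof.
split=> [[xs [<- xsP xsS]]|].
  have psort : pairwise <=%R (sort <=%R xs).
    rewrite -sorted_pairwise; last exact: le_trans.
    exact: sort_le_sorted.
  have : pairwise (sep t) (sort <=%R xs).
    apply: pairwise_perm xsS; first exact: sep_sym.
    by rewrite perm_sym perm_sort.
  have : all (fun x => (a <= x <= b) && (h x <= s)) (sort <=%R xs).
    by rewrite all_sort.
  rewrite -(size_sort <=%R xs).
  move: (sort <=%R xs) psort => {xsP xsS}{}xs; elim: xs a => //= x xs IH a.
  move=> /andP[xxs ps] /andP[/andP[axb xs'] xsP] /andP[xsep xsS].
  exists x; split => //.
  case: xs IH xxs ps xsP xsep xsS => [|x2 xs] IH xxs ps xsP xsep xsS; [by left|right].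
  have /asboolP[y xyx2 ty] : sep t x x2 by case/andP: xsep.
  have xx2 : x <= x2 by case/andP: xxs.
  have {}xyx2 : x <= y <= x2.
    by case/orP: xyx2 => // /andP[? ?]; apply/andP; split; lra.
  have x2b : x2 <= b by move: xsP => /= /andP[/andP[/andP[]]].
  exists y; split => //; first by lra.
  apply: IH => //; apply/allP => z zP.
  have /andP[/andP[_ ->] ->] := allP xsP _ zP.
  rewrite !andbT.
  have : x2 <= z.
    move: zP; rewrite inE => /orP[/eqP->//|zP].
    by move: ps => /= /andP[/allP/(_ _ zP)].
  by lra.
elim: m a => [|m IH] a /=; first by move=> _; exact: comp_ge0.
move=> [x [axb hx]] [->|[y [xyb hy /IH[xs [sz /allP xsP xsS]]]]].
  by exists [:: x]; split => //=; rewrite axb hx.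
exists (x :: xs); split => /=; first by rewrite sz.
  rewrite axb hx /=; apply/allP => z /xsP/andP[/andP[yz ->] ->]; rewrite !andbT.
  by lra.
rewrite xsS andbT; apply/allP => z /xsP/andP[/andP[yz zb] _].
by apply/asboolP; exists y => //; apply/orP; left; lra.
Qed.

End Separation.

(** * Finiteness of the number of components *)

Section ComponentCount.
Context {R : realType} (h : R -> R) (h_cont : continuous h).
Implicit Types (a b s t x y z : R) (m : nat) (xs : seq R).

Lemma cont_dist x (e : R) : 0 < e -> exists2 r, 0 < r &
  forall y, `|x - y| < r -> `|h x - h y| < e.
Proof.
move=> e0; have /cvgrPdist_lt/(_ _ e0)/nbhs_ballP[r /= r0 rP] := @h_cont x.
by exists r => // y xy; exact: rP.
Qed.

Lemma unif_cont_seg a b (e : R) : 0 < e -> exists2 d, 0 < d &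
  forall x y, a <= x <= b -> `|x - y| < d -> `|h x - h y| < e.
Proof.
move=> e0.
have /compact_near_coveringP/(_ R 0^'+ (fun d x => forall y, `|x - y| < d -> `|h x - h y| < e)) :=
  @segment_compact R a b.
have F : Filter (0 : R)^'+ by exact: _.
move=> /(_ F); case.
- move=> x _.
  have [r r0 rP] := cont_dist x (divr_gt0 e0 (ltr0Sn _ 1)).
  have r20 : 0 < r / 2 by rewrite divr_gt0.
  exists (ball x (r / 2), `]0, r / 2[%classic) => /=.
    split; first exact: nbhsx_ballx.
    by exists (r / 2) => //= z /=; rewrite sub0r normrN in_itv/= => zr z0;
      rewrite z0 (le_lt_trans (ler_norm _)).
  move=> [x' d] /= [xx' +] y x'y; rewrite in_itv/= => /andP[d0 dr].
  have h1 : `|h x - h x'| < e / 2.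
    by apply: rP; apply: lt_le_trans xx' _; lra.
  have h2 : `|h x - h y| < e / 2.
    apply: rP; rewrite (_ : x - y = (x - x') + (x' - y)); last by lra.
    by apply: le_lt_trans (ler_normD _ _) _; move: xx'; rewrite /ball/=; lra.
  rewrite (_ : h x' - h y = - (h x - h x') + (h x - h y)); last by lra.
  by apply: le_lt_trans (ler_normD _ _) _; rewrite normrN; lra.
- move=> r /= r0 rP; exists (r / 2); first by rewrite divr_gt0.
  move=> x y xab; apply: (rP (r / 2)) => /=; last by rewrite in_itv.
    by rewrite sub0r normrN gtr0_norm; lra.
  by rewrite divr_gt0.
Qed.

(** Between a point of the chain and the next separating point [h] climbs by more than [t - s]. By
    uniform continuity each climb takes a length of at least [d], so at most [(b - a) / d + 1]
    points fit. *)
Lemma chain_bounded a b s t : s < t -> exists N, forall m, chain h s t m a b -> (m <= N)%N.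
Proof.
move=> st.
have [|d d0 dP] := @unif_cont_seg a b (t - s); first by rewrite subr_gt0.
have key m u : a <= u -> chain h s t m.+1 u b -> u + m%:R * d <= b.
  elim: m u => [|m IH] u au; first by case=> x [/andP[ux xb] _ _]; lra.
  move=> [x [/andP[ux xb] hx [//|[y [/andP[xy yb] hy c]]]]].
  have := IH y ltac:(lra) c.
  have : d <= y - x.
    rewrite leNgt; apply/negP => yxd.
    have := dP x y ltac:(lra); rewrite distrC ger0_norm ?subr_ge0// => /(_ yxd).
    by rewrite distrC => /(le_lt_trans (ler_norm _)); lra.
  by rewrite -(natr1 m) mulrDl mul1r; lra.
exists (Num.truncn ((b - a) / d)).+1 => -[//|m] /(key _ _ (lexx a)) amb.
by rewrite ltnS -(@natrK R m); apply: le_truncn; rewrite ler_pdivlMr//; lra.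
Qed.

(** Built with the same [xget] as [H0_rank], so that the two agree as soon as the sets of admissible
    sizes do. For [s < t] a largest size exists by [chain_bounded]. *)
Definition ncomp a b s t : nat := xget 0%N
  [set m | comp_ge h a b s t m /\ forall m', comp_ge h a b s t m' -> (m' <= m)%N].

Lemma ncompP a b s t : s < t -> comp_ge h a b s t (ncomp a b s t) /\
  forall m, comp_ge h a b s t m -> (m <= ncomp a b s t)%N.
Proof.
move=> st; rewrite /ncomp; case: xgetP => [m _ //|] H; exfalso.
have [N NP] := @chain_bounded a b s t st.
have ex : exists m, `[< comp_ge h a b s t m >] by exists 0%N; apply/asboolP/comp_ge0.
have ub m : `[< comp_ge h a b s t m >] -> (m <= N)%N.
  by move=> /asboolP/comp_ge_chain/NP.
by case: (ex_maxnP ex ub) => M /asboolP MP Mmax; apply: (H M); split=> // m /asboolP; exact: Mmax.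
Qed.

Lemma ncomp_geP a b s t m : s < t -> (m <= ncomp a b s t)%N <-> comp_ge h a b s t m.
Proof.
move=> st; have [? ub] := ncompP a b st; split=> [mn|/ub//].
exact: comp_ge_le mn _.
Qed.

(** A family of maximal size meets every component concerned, since a point separated from all its
    members could be added. *)
Lemma ncomp_max a b s t : s < t -> exists xs, [/\ size xs = ncomp a b s t,
  all (fun x => (a <= x <= b) && (h x <= s)) xs, pairwise (sep h t) xs &
  forall y, a <= y <= b -> h y <= s -> exists2 x, x \in xs & ~~ sep h t y x].
Proof.
move=> st; have [[xs [sz xsP xsS]] ub] := ncompP a b st.
exists xs; split => // y yab ys; apply: contrapT => H.
have : comp_ge h a b s t (ncomp a b s t).+1.
  exists (y :: xs); split => /=; [by rewrite sz|by rewrite yab ys|].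
  rewrite xsS andbT; apply/allP => x xxs; apply/negPn/negP => n.
  by apply: H; exists x.
by move=> /ub; rewrite ltnn.
Qed.

End ComponentCount.

Lemma near_all_mem {T : eqType} {U : Type} {F : set_system U} {FF : Filter F}
    (xs : seq T) (P : T -> U -> Prop) :
  (forall x, x \in xs -> \forall u \near F, P x u) ->
  \forall u \near F, forall x, x \in xs -> P x u.
Proof.
elim: xs => [|x xs IH] H; first by apply: nearW.
have h1 := H x (mem_head _ _).
have h2 : \forall u \near F, forall x, x \in xs -> P x u.
  by apply: IH => y yxs; apply: H; rewrite inE yxs orbT.
near=> u => y; rewrite inE => /orP[/eqP->|]; first by near: u.
by move: y; near: u.
Unshelve. all: by end_near. Qed.

(** * Alternating sums and right continuity of the component count *)

Section PersistenceRank.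
Context {R : realType} (h : R -> R) (h_cont : continuous h) (a b : R).
Implicit Types (s t x y z : R) (m : nat) (xs : seq R).

(** Each point may be moved within its component to a point of [{h <= s}]; by [sep_congr] the new
    points remain separated. *)
Lemma comp_ge_replace s t xs : pairwise (sep h t) xs ->
  (forall x, x \in xs ->
    exists y, [/\ a <= y <= b, h y <= s & ~~ sep h t x y]) ->
  comp_ge h a b s t (size xs).
Proof.
move=> xsS H.
pose f x := xget x [set y | [/\ a <= y <= b, h y <= s & ~~ sep h t x y]].
have fP x : x \in xs -> [/\ a <= f x <= b, h (f x) <= s & ~~ sep h t x (f x)].
  by move=> /H[y yP]; rewrite /f; case: xgetP => [z _ //|/(_ y)].
exists (map f xs); split; first by rewrite size_map.
  by rewrite all_map; apply/allP => x /fP[/= -> ->].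
rewrite pairwise_map.
apply: (sub_in_pairwise (P := mem xs)) xsS => [x y xxs yxs|]; last exact/allP.
by have [_ _ xf] := fP x xxs; have [_ _ yf] := fP y yxs; exact: sep_congr.
Qed.

(** Take maximal families [P] at [(s, t)] and [Q] at [(s', t')]. The members of [Q] whose component
    at level [t'] reaches [{h <= s}] are counted at [(s, t')]; the others are separated from all of
    [P] and enlarge it to a family at [(s', t)]. *)
Lemma ncomp_alternating s s' t t' : s <= s' -> s' < t -> t <= t' ->
  (ncomp h a b s t + ncomp h a b s' t' <= ncomp h a b s' t + ncomp h a b s t')%N.
Proof.
move=> ss' s't tt'.
have [[P [szP PP PS]] _] := ncompP h_cont a b (le_lt_trans ss' s't).
have [[Q [szQ QP QS]] _] := ncompP h_cont a b (lt_le_trans s't tt').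
pose inX q := `[< exists y, [/\ a <= y <= b, h y <= s & ~~ sep h t' q y] >].
have QaE : (size [seq q <- Q | inX q] <= ncomp h a b s t')%N.
  apply/(ncomp_geP h_cont); first exact: le_lt_trans ss' (lt_le_trans s't tt').
  apply: comp_ge_replace; first exact: pairwise_filter.
  by move=> x; rewrite mem_filter => /andP[/asboolP].
have : (size P + size [seq q <- Q | ~~ inX q] <= ncomp h a b s' t)%N.
  apply/(ncomp_geP h_cont) => //.
  exists (P ++ [seq q <- Q | ~~ inX q]); split; first by rewrite size_cat.
    rewrite all_cat; apply/andP; split; apply/allP => x.
      by move=> /(allP PP)/andP[-> xs]/=; exact: le_trans xs ss'.
    by rewrite mem_filter => /andP[_ /(allP QP)].
  rewrite pairwise_cat PS (sub_pairwise _ (pairwise_filter _ QS)); last first.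
    by move=> x y; exact: sep_le.
  rewrite !andbT; apply/allrelP => x y /(allP PP)/andP[xab xs].
  rewrite mem_filter => /andP[/= /asboolP yX _].
  apply: (sep_le tt'); rewrite sep_sym; apply/negPn/negP => yx.
  by apply: yX; exists x.
have : (size [seq q <- Q | inX q] + size [seq q <- Q | ~~ inX q] = size Q)%N.
  by rewrite !size_filter -(count_predC inX Q).
lia.
Qed.

(** Finitely many separating points have values strictly above [t], hence above every [t'] close
    enough to [t]. *)
Lemma ncomp_right_contr s t : s < t ->
  \forall t' \near t^'+, ncomp h a b s t' = ncomp h a b s t.
Proof.
move=> st; have [[P [szP PP PS]] _] := ncompP h_cont a b st.
have nearsep x y : sep h t x y -> \forall t' \near t^'+, sep h t' x y.
  move=> /asboolP[z xzy tz]; near=> t'.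
  have t'z : t' < h z by near: t'; exact: nbhs_right_lt.
  by apply/asboolP; exists z.
have nearall : \forall t' \near t^'+, pairwise (sep h t') P.
  elim: P {szP PP} PS => [_|x P IH /= /andP[/allP xP PS]]; first exact: nearW.
  have /near_all_mem H : forall y, y \in P -> \forall t' \near t^'+, sep h t' x y.
    by move=> y /xP; exact: nearsep.
  have {}IH := IH PS.
  near=> t'; apply/andP; split; last by near: t'.
  by apply/allP; near: t'.
near=> t'; have tt' : t < t' by near: t'; exact: nbhs_right_gt.
have st' := lt_trans st tt'.
apply/eqP; rewrite eqn_leq; apply/andP; split.
  apply/(ncomp_geP h_cont) => //; have [[Q [<- QP QS]] _] := ncompP h_cont a b st'.
  by exists Q; split => //; apply: sub_pairwise QS => x y; exact: sep_le (ltW tt').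
by apply/(ncomp_geP h_cont) => //; exists P; split => //; near: t'.
Unshelve. all: by end_near. Qed.

Lemma sep_open t q : h q <= t -> open [set x | sep h t q x].
Proof.
move=> qt; rewrite openE => x /asboolP[z qzx tz].
have [r r0 rP] := @cont_dist _ h h_cont z (h z - t) ltac:(by rewrite subr_gt0).
have {}rP y : `|z - y| < r -> t < h y.
  by move=> /rP zy; have := le_lt_trans (ler_norm _) zy; lra.
(* As [h q <= t], the point [q] is at distance at least [r] from [z]. So [z] can be shifted by
   [r / 2] towards [q] and still separate [q] from all points within [r / 2] of [x]. *)
have rz : r <= `|z - q| by rewrite leNgt; apply/negP => /rP; lra.
apply/nbhs_ballP; exists (r / 2) => /=; first by rewrite divr_gt0.
move=> x'; rewrite /ball /= ltr_distl => /andP[x'1 x'2]; apply/asboolP.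
case/orP: qzx => /andP[u v].
- exists (z - r / 2); last by apply: rP; rewrite opprB addrC subrK gtr0_norm; lra.
  by apply/orP; left; move: rz; rewrite ger0_norm; lra.
- exists (z + r / 2).
    by apply/orP; right; move: rz; rewrite ler0_norm; lra.
  by apply: rP; rewrite opprD addrA subrr add0r normrN gtr0_norm; lra.
Qed.

(** The component of [q] is compact by [sep_open], so [h] has a minimum on it. Either this minimum
    is at most [s], or it exceeds every [s'] close enough to [s]. *)
Lemma comp_reach_near s t q : a <= q <= b -> h q <= t ->
  \forall s' \near s^'+,
    (exists y, [/\ a <= y <= b, h y <= s' & ~~ sep h t q y]) ->
    (exists y, [/\ a <= y <= b, h y <= s & ~~ sep h t q y]).
Proof.
move=> qab qt.
pose C := `[a, b]%classic `&` ~` [set x | sep h t q x].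
have cC : compact C.
  by apply: compact_closedI; [exact: segment_compact|exact/open_closedC/sep_open].
have C0 : C !=set0.
  by exists q; split; rewrite /= ?in_itv//=; apply/negP; rewrite sep_irr.
have [c cC' cmin] := compact_EVT_min C0 cC (continuous_subspaceT h_cont).
have [hc|hc] := leP (h c) s.
  apply: nearW => s' _; exists c; move: cC'; rewrite inE => -[/=].
  by rewrite in_itv /= => ? /negP.
near=> s' => -[y [yab ys yq]]; exfalso.
have : h c <= h y.
  by apply: cmin; rewrite inE; split; [rewrite /= in_itv|exact/negP].
have : s' < h c by near: s'; exact: nbhs_right_lt.
lra.
Unshelve. all: by end_near. Qed.

Lemma ncomp_right_contl s t : s < t ->
  \forall s' \near s^'+, ncomp h a b s' t = ncomp h a b s t.
Proof.
(* An intermediate level gives one finite family [Q] of representatives that serves all [s'] below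
   [s0], so that [comp_reach_near] is needed at finitely many points only. *)
move=> st; pose s0 := (s + t) / 2.
have ss0 : s < s0 by rewrite /s0; lra.
have s0t : s0 < t by rewrite /s0; lra.
have [Q [_ /allP QP QS Qmax]] := ncomp_max h_cont a b s0t.
have QN q : q \in Q -> \forall s' \near s^'+,
    (exists y, [/\ a <= y <= b, h y <= s' & ~~ sep h t q y]) ->
    (exists y, [/\ a <= y <= b, h y <= s & ~~ sep h t q y]).
  by move=> /QP/andP[qab qs]; apply: comp_reach_near => //; lra.
have {QN}QN := near_all_mem QN.
near=> s'; have ss' : s < s' by near: s'; exact: nbhs_right_gt.
have s's0 : s' < s0 by near: s'; exact: nbhs_right_lt.
have s't := lt_trans s's0 s0t.
apply/eqP; rewrite eqn_leq; apply/andP; split; last first.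
  apply/(ncomp_geP h_cont) => //; have [[P [<- PP PS]] _] := ncompP h_cont a b st.
  exists P; split => //; apply/allP => x /(allP PP)/andP[-> xs]/=.
  exact: le_trans xs (ltW ss').
apply/(ncomp_geP h_cont) => //.
have [[P [<- /allP PP PS]] _] := ncompP h_cont a b s't.
apply: comp_ge_replace => // x /PP/andP[xab xs'].
have [q qQ xq] := Qmax _ xab (le_trans xs' (ltW s's0)).
have [y [yab ys qy]] : exists y, [/\ a <= y <= b, h y <= s & ~~ sep h t q y].
  have QNs' : forall q, q \in Q ->
      (exists y, [/\ a <= y <= b, h y <= s' & ~~ sep h t q y]) ->
      (exists y, [/\ a <= y <= b, h y <= s & ~~ sep h t q y]).
    by near: s'; exact: QN.
  by apply: QNs' => //; exists x; split => //; rewrite sep_sym.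
exists y; split => //; apply/negP => /(@sep_trans _ _ _ _ q).
by rewrite (negbTE xq) (negbTE qy).
Unshelve. all: by end_near. Qed.

(** The test encodes the convention that the persistence module vanishes from the maximum of the
    function on. *)
Definition prank s t : nat :=
  if `[< exists2 z, a <= z <= b & t < h z >] then ncomp h a b s t else 0%N.

Lemma prank_alternating s s' t t' : s <= s' -> s' < t -> t <= t' ->
  (prank s t + prank s' t' <= prank s' t + prank s t')%N.
Proof.
move=> ss' s't tt'; rewrite /prank; case: asboolP => [_|nt].
- case: asboolP => [_|_]; first exact: ncomp_alternating.
  (* The maximum lies in []t, t']]: both ranks at [t'] vanish, and monotonicity in [s] remains. *)
  rewrite !addn0; apply/(ncomp_geP h_cont) => //.
  have [[P [<- PP PS]] _] := ncompP h_cont a b (le_lt_trans ss' s't).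
  exists P; split => //; apply/allP => x /(allP PP)/andP[-> xs]/=.
  exact: le_trans xs ss'.
- case: asboolP => // -[z zab tz]; exfalso; apply: nt; exists z => //.
  exact: le_lt_trans tz.
Qed.

Lemma prank_right_contl s t : s < t ->
  \forall s' \near s^'+, prank s' t = prank s t.
Proof.
rewrite /prank; case: asboolP => _; first exact: ncomp_right_contl.
by move=> _; exact: nearW.
Qed.

Lemma prank_right_contr s t : s < t ->
  \forall t' \near t^'+, prank s t' = prank s t.
Proof.
rewrite /prank; case: asboolP => [[z zab tz] st|nt _].
  near=> t'; rewrite asboolT; last first.
    by exists z => //; near: t'; exact: nbhs_right_lt.
  by near: t'; exact: ncomp_right_contr.
near=> t'; rewrite asboolF// => -[z zab tz]; apply: nt; exists z => //.
by apply: lt_trans tz; near: t'; exact: nbhs_right_gt.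
Unshelve. all: by end_near. Qed.

Lemma prank_out (M : R) s t : (forall x, `|h x| < M) -> s <= - M \/ M <= t ->
  prank s t = 0%N.
Proof.
move=> hM [sM|Mt]; rewrite /prank; case: asboolP => // -[z zab tz].
  rewrite /ncomp; case: xgetP => // -[|m] _ [[xs [sz /allP xsP _]] _] //.
  case: xs sz xsP => // x xs _ /(_ x (mem_head _ _))/andP[_ xs'].
  by exfalso; have := hM x; rewrite ltr_norml; lra.
by exfalso; have := hM z; rewrite ltr_norml; lra.
Qed.

End PersistenceRank.

(** * Rank in degree zero homology *)

Lemma pairwise_in (T : eqType) (r : rel T) (s : seq T) : symmetric r ->
  pairwise r s -> {in s &, forall x y, x != y -> r x y}.
Proof.
move=> rsym; elim: s => // x s IH /= /andP[/allP xs ps] y z.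
rewrite !inE => /orP[/eqP->|ys] /orP[/eqP->|zs]; rewrite ?eqxx//.
- by move=> _; exact: xs.
- by move=> _; rewrite rsym; exact: xs.
- exact: IH.
Qed.

Section FreegLift.
Context (K : fieldType) (T : choiceType) (M : lmodType K) (f : T -> M).

HB.instance Definition _ :=
  GRing.isAdditive.Build {freeg T / K} M (fglift f) (lift_is_additive f).

Lemma fglift_sumE (D : {freeg T / K}) :
  fglift f D = \sum_(x <- dom D) coeff x D *: f x.
Proof.
rewrite -[in LHS](freeg_sumE D) raddf_sum /=.
by apply: eq_bigr => x _; rewrite liftU.
Qed.

Lemma fgliftZ c (D : {freeg T / K}) : fglift f (c *: D) = c *: fglift f D.
Proof.
rewrite -[c *: D]/(fgscale c D) /fgscale raddf_sum /= fglift_sumE scaler_sumr.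
by apply: eq_bigr => x _; rewrite liftU scalerA.
Qed.

End FreegLift.

Section HomologyRank.
Context (R : realType) (K : fieldType) (X : topologicalType).
Variables (A B : set X) (AB : A `<=` B) (conn : rel X).
Hypothesis conn_refl : forall x, B x -> conn x x.
Hypothesis conn_sym : symmetric conn.
Hypothesis conn_trans : transitive conn.
Hypothesis conn_path : forall s : simplex1 R X, range s `<=` B ->
  conn (s (segment_left ler01)) (s (segment_right ler01)).
Hypothesis path_conn : forall x y, B x -> B y -> conn x y ->
  exists s : simplex1 R X, [/\ range s `<=` B, s (segment_left ler01) = x
    & s (segment_right ler01) = y].

(** Total coefficient of [D] on the class of [q]. These functionals vanish on boundaries and
    together detect the classes in [H_0(B)]. *)
Definition class_sum (q : X) (D : {freeg X / K}) : K :=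
  fglift (fun x => (conn q x)%:R : K^o) D.

Lemma class_sumU q c x : class_sum q << c *g x >> = c * (conn q x)%:R.
Proof. by rewrite /class_sum liftU. Qed.

Lemma class_sum_linear q I (s : seq I) (a : I -> K) (D : I -> {freeg X / K}) :
  class_sum q (\sum_(i <- s) a i *: D i) = \sum_(i <- s) a i * class_sum q (D i).
Proof.
by rewrite /class_sum raddf_sum /=; apply: eq_bigr => i _; rewrite fgliftZ.
Qed.

(** The two ends of a path in [B] lie in the same class, so their contributions cancel. *)
Lemma class_sum_boundary q D : boundary0 R B D -> class_sum q D = 0.
Proof.
move=> [c cB <-]; rewrite /boundary fglift_sumE class_sum_linear big_seq big1// => s sc.
have sB := cB s sc.
rewrite /class_sum raddfB /= !liftU !scale1r.
have e : conn q (s (segment_right ler01)) = conn q (s (segment_left ler01)).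
  apply/idP/idP => h; apply: conn_trans h _; last exact: conn_path.
  by rewrite conn_sym; exact: conn_path.
by rewrite e subrr mulr0.
Qed.

Lemma boundary0_0 : @boundary0 R K X B 0.
Proof. by exists 0 => [s|]; rewrite ?dom0// /boundary raddf0. Qed.

Lemma boundary0D D D' : boundary0 R B D -> boundary0 R B D' ->
  @boundary0 R K X B (D + D').
Proof.
move=> [c cB <-] [c' cB' <-]; exists (c + c'); last by rewrite /boundary raddfD.
by move=> s /domD_subset; rewrite mem_cat => /orP[/cB|/cB'].
Qed.

Lemma boundary0Z a D : boundary0 R B D -> @boundary0 R K X B (a *: D).
Proof.
move=> [c cB <-]; exists (a *: c); last by rewrite /boundary fgliftZ.
by move=> s /domZ_subset/cB.
Qed.

Lemma boundary0_sum I (s : seq I) (D : I -> {freeg X / K}) :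
  (forall i, boundary0 R B (D i)) -> boundary0 R B (\sum_(i <- s) D i).
Proof.
move=> HD; elim: s => [|i s IH]; last by rewrite big_cons; exact: boundary0D.
by rewrite big_nil; exact: boundary0_0.
Qed.

Lemma boundary0_conn x y : B x -> B y -> conn x y ->
  @boundary0 R K X B (<< y >> - << x >>).
Proof.
move=> Bx By /(path_conn Bx By)[s [sB <- <-]]; exists << s >>.
  by move=> s'; rewrite domU1 inE => /eqP->.
by rewrite /boundary liftU scale1r.
Qed.

(** Greedy choice: a point is kept only if it is connected to none of those already kept. *)
Lemma class_reps (D : seq X) : (forall x, x \in D -> A x) ->
  exists ys, [/\ {subset ys <= D}, pairwise (fun x y => ~~ conn x y) ys &
    forall x, x \in D -> exists2 y, y \in ys & conn x y].
Proof.
elim: D => [|x D IH] DA; first by exists [::].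
have [|ys [ysD ysP ysmax]] := IH; first by move=> y yD; apply: DA; rewrite inE yD orbT.
have [/hasP[y yys xy]|xys] := boolP (has (conn x) ys).
  exists ys; split => //; first by move=> z /ysD zD; rewrite inE zD orbT.
  by move=> z; rewrite inE => /orP[/eqP->|/ysmax//]; exists y.
exists (x :: ys); split.
- by move=> z; rewrite !inE => /orP[->//|/ysD->]; rewrite orbT.
- by rewrite /= ysP andbT; rewrite -all_predC in xys.
- move=> z; rewrite inE => /orP[/eqP->|/ysmax[y yys zy]].
    by exists x; rewrite ?mem_head//; apply/conn_refl/AB/DA/mem_head.
  by exists y => //; rewrite inE yys orbT.
Qed.

(** Modulo boundaries each point may be replaced by its representative. This turns [D] into the
    combination of the [ys] with coefficients [class_sum y D], which are all zero. *)
Lemma boundary0_class_sum (ys : seq X) (D : {freeg X / K}) : chain0 A D ->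
  (forall y, y \in ys -> A y) -> pairwise (fun x y => ~~ conn x y) ys ->
  (forall x, x \in dom D -> exists2 y, y \in ys & conn x y) ->
  (forall y, y \in ys -> class_sum y D = 0) -> boundary0 R B D.
Proof.
move=> DA ysA ysP ysD ys0.
(* The representative of [x] is written as a sum over all of [ys] with one nonzero term, so that
   exchanging the sums later produces [class_sum]. *)
have rep x : x \in dom D ->
    boundary0 R B (<< x >> - \sum_(y <- ys) (conn y x)%:R *: << y >> : {freeg X / K}).
  move=> xD; have [y0 y0ys xy0] := ysD x xD.
  rewrite (bigD1_seq y0) //=; last first.
    elim: ys ysP ysA {ysD ys0 y0ys} => //= y ys IH /andP[/allP yP ysP] ysA.
    rewrite IH// ?andbT; last by move=> z zys; apply: ysA; rewrite inE zys orbT.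
    apply/negP => /yP; rewrite conn_refl//; apply/AB/ysA/mem_head.
  rewrite big_seq_cond big1 ?addr0.
    rewrite conn_sym xy0 scale1r; apply: boundary0_conn; last by rewrite conn_sym.
      exact/AB/ysA.
    exact/AB/DA.
  move=> y /andP[yys yy0]; case: (boolP (conn y x)) => [yx|_]; last by rewrite scale0r.
  have := pairwise_in _ ysP yys y0ys yy0; rewrite (conn_trans yx xy0) => H.
  by have /H : symmetric (fun x y => ~~ conn x y) by move=> u v; rewrite conn_sym.
rewrite -[D]freeg_sumE.
(* The conditional makes every summand a boundary, also outside [dom D], as [boundary0_sum]
   requires. *)
have -> : \sum_(z <- dom D) << coeff z D *g z >> =
    \sum_(x <- dom D) coeff x D *: (if x \in dom D then
      (<< x >> - \sum_(y <- ys) (conn y x)%:R *: << y >> : {freeg X / K}) else 0).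
  transitivity (\sum_(x <- dom D) coeff x D *: (<< x >> : {freeg X / K}) -
      \sum_(y <- ys) class_sum y D *: << y >>).
    rewrite [X in _ - X]big_seq [X in _ - X]big1 ?subr0; last first.
      by move=> y /ys0->; rewrite scale0r.
    apply: eq_bigr => x _; apply/eqP/freeg_eqP => z.
    by rewrite coeffZ !coeffU mul1r.
  under [X in _ - X]eq_bigr => y _ do
    rewrite /class_sum fglift_sumE scaler_suml.
  rewrite exchange_big /= -sumrB big_seq [RHS]big_seq; apply: eq_bigr => x xD.
  rewrite xD scalerBr; congr (_ - _); rewrite scaler_sumr; apply: eq_bigr => y _.
  by rewrite scalerA.
apply: boundary0_sum => x; apply: boundary0Z; case: ifP => [/rep//|_].
exact: boundary0_0.
Qed.

(** The rank is the number of classes of [B] that meet [A]. Points in distinct classes are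
    independent because [class_sum] tells them apart. Conversely, more chains than classes admit a
    nontrivial combination with zero class sums, which is a boundary. *)
Lemma H0_rank_geP m : H0_rank_ge R K A B m <->
  exists xs : seq X, [/\ size xs = m, forall x, x \in xs -> A x &
    pairwise (fun x y => ~~ conn x y) xs].
Proof.
have nsym : symmetric (fun x y => ~~ conn x y) by move=> u v; rewrite conn_sym.
split=> [[c [cA cfree]]|[xs [sz xsA xsP]]].
- have [|ys [ysD ysP ysmax]] := @class_reps (flatten [seq dom (c i) | i <- enum 'I_m]).
    by move=> x /flatten_mapP[i _]; exact: cA.
  have ysA y : y \in ys -> A y by move=> /ysD/flatten_mapP[i _]; exact: cA.
  have [mys|ysm] := leqP m (size ys).
    exists (take m ys); split; first by rewrite size_takel.
      by move=> x /mem_take/ysA.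
    exact: subseq_pairwise (take_subseq _ _) ysP.
  (* With more rows than columns, [C] has a nonzero vector in its left kernel. *)
  pose C := \matrix_(i < m, j < size ys) class_sum (tnth (in_tuple ys) j) (c i).
  have /rowV0Pn[v vC v0] : kermx C != 0.
    rewrite kermx_eq0 /row_free neq_ltn (leq_ltn_trans (rank_leq_col C))//.
  move/sub_kermxP in vC; exfalso; move/eqP: v0; apply.
  apply/rowP => i; rewrite mxE; apply: (cfree (fun i => v 0 i)).
  apply: (@boundary0_class_sum ys) => //.
  + move=> x /dom_sum_subset/flatten_mapP[j _ /domZ_subset]; exact: cA.
  + move=> x /dom_sum_subset/flatten_mapP[j jm /domZ_subset xj].
    by apply: ysmax; apply/flatten_mapP; exists j => //; rewrite mem_enum.
  + move=> y yys; rewrite class_sum_linear.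
    have ysi : (index y ys < size ys)%N by rewrite index_mem.
    have /rowP/(_ (Ordinal ysi)) := vC; rewrite !mxE => vC0.
    rewrite -[RHS]vC0; apply: eq_bigr => j _; rewrite mxE.
    by rewrite (tnth_nth y) /= nth_index.
- subst m; exists (fun i => << tnth (in_tuple xs) i >>); split.
    by move=> i x; rewrite domU1 inE => /eqP ->; apply/xsA/mem_tnth.
  move=> a /class_sum_boundary aB i.
  have := aB (tnth (in_tuple xs) i); rewrite class_sum_linear (bigD1 i)//= big1.
    rewrite class_sumU mul1r conn_refl ?mulr1 ?addr0//.
    exact/AB/xsA/mem_tnth.
  move=> j ji; rewrite class_sumU mul1r; apply/eqP; rewrite mulf_eq0; apply/orP; right.
  have uxs : uniq xs.
    elim: xs xsP xsA {a aB i j ji} => //= y ys IH /andP[/allP yP ysP] ysA.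
    rewrite IH// ?andbT; last by move=> z zys; apply: ysA; rewrite inE zys orbT.
    apply/negP => /yP; rewrite conn_refl//; apply/AB/ysA/mem_head.
  have := pairwise_in nsym xsP (mem_tnth i (in_tuple xs)) (mem_tnth j (in_tuple xs)).
  rewrite (inj_eq (elimT (tuple_uniqP (in_tuple xs)) uxs)) eq_sym ji => /(_ isT)/negbTE->.
  by rewrite eqxx.
Qed.

End HomologyRank.

(** * Reparametrization *)

Section SegmentClamp.
Context {R : realType} (a b : R) (ab : a <= b).

Lemma clamp_subproof (u : R) : Num.min (Num.max u a) b \in segment a b.
Proof.
by apply/mem_set; rewrite /segment /= in_itv /= le_min le_max ge_min !lexx ab !orbT.
Qed.

(** A continuous retraction of the line onto the segment, used to transfer the intermediate value
    theorem and affine paths to the subtype. *)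
Definition clamp (u : R) : segment a b :=
  exist (fun x => x \in segment a b) _ (clamp_subproof u).

Lemma clamp_continuous : continuous clamp.
Proof.
apply: continuous_comp_initial => u.
apply: (@continuous_min R R (fun u => Num.max u a) (cst b)); last exact: cst_continuous.
apply: (@continuous_max R R id (cst a)); [exact: cvg_id|exact: cst_continuous].
Qed.

Lemma segment_itv (x : segment a b) : a <= val x <= b.
Proof. by case: x => u /= /set_mem; rewrite /segment /= in_itv. Qed.

Lemma val_clamp u : a <= u <= b -> val (clamp u) = u.
Proof. by move=> /andP[au ub]; rewrite /= (max_idPl au) (min_idPl ub). Qed.



Lemma segment_val_continuous : continuous (val : segment a b -> R).
Proof. exact: initial_continuous. Qed.

Lemma segment_IVT (g : segment a b -> R) (v : R) : continuous g ->
  Num.min (g (segment_left ab)) (g (segment_right ab)) <= v <=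
    Num.max (g (segment_left ab)) (g (segment_right ab)) ->
  exists x, g x = v.
Proof.
move=> cg.
have -> : segment_left ab = clamp a by apply/val_inj; rewrite val_clamp// lexx.
have -> : segment_right ab = clamp b by apply/val_inj; rewrite val_clamp// lexx andbT.
move=> /(@IVT _ (g \o clamp) _ _ _ ab)[|u _ <-]; last by exists (clamp u).
apply: continuous_subspaceT => u; apply: continuous_comp; last exact: cg.
exact: clamp_continuous.
Qed.

End SegmentClamp.

Section ReparametrizedRank.
Context {R : realType} (K : fieldType) (phi : R -> R) (a b : R) (ab : a <= b).
Variables (g : segment a b -> R) (g_cont : continuous g).
Hypothesis g_incr : forall x y : segment a b, val x < val y -> g x < g y.

Let gl := g (segment_left ab).
Let gr := g (segment_right ab).

Lemma g_ler (x y : segment a b) : val x <= val y -> g x <= g y.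
Proof.
rewrite le_eqVlt => /orP[/eqP/val_inj->//|/g_incr/ltW//].
Qed.

Lemma g_itv (x : segment a b) : gl <= g x <= gr.
Proof.
by have /andP[ax xb] := segment_itv x; apply/andP; split; apply: g_ler.
Qed.

Lemma g_surj v : gl <= v <= gr -> exists x, g x = v.
Proof.
move=> /andP[lv vr]; apply: (segment_IVT (ab := ab) g_cont).
by rewrite ge_min le_max -/gl -/gr lv vr orbT.
Qed.

(** Points count as connected when their images under [g] are not separated. The affine path then
    joins them inside the sublevel set, as monotonicity keeps [g] along it between the two
    images. *)
Lemma H0_rank_ge_comp (s t : R) m : s <= t ->
  H0_rank_ge R K (sublevel (phi \o g) s) (sublevel (phi \o g) t) m <->
  comp_ge phi gl gr s t m.
Proof.
move=> st; pose conn (x y : segment a b) := ~~ sep phi t (g x) (g y).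
have sepE : (fun x y => ~~ conn x y) = relpre g (sep phi t).
  by apply/funext => x; apply/funext => y; rewrite /conn negbK.
have paths (x y : segment a b) : conn x y -> exists sg : simplex1 R (segment a b),
    [/\ range sg `<=` sublevel (phi \o g) t, sg (segment_left ler01) = x
      & sg (segment_right ler01) = y].
  move=> xy.
  (* [clamp] only gives the affine path its type; by [lineE] it changes no value. *)
  pose line (u : segment (0 : R) 1) := clamp ab (val x + val u * (val y - val x)).
  have line_cont : continuous line.
    have affine_cont : continuous (fun v : R => val x + v * (val y - val x)).
      move=> v; apply: (@cvgD _ R^o _ (nbhs v) _ (fun=> val x) (fun v => v * _)).
        exact: cvg_cst.
      by apply: cvgM; [exact: cvg_id|exact: cvg_cst].
    have -> : line = (clamp ab \o (fun v : R => val x + v * (val y - val x))) \o val by [].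
    move=> u; apply: continuous_comp; first exact: segment_val_continuous.
    by apply: continuous_comp; [exact: affine_cont|exact: clamp_continuous].
  have lineE u : val (line u) = val x + val u * (val y - val x).
    apply: val_clamp.
    have := segment_itv x; have := segment_itv y; have := segment_itv u.
    by move: (val x) (val y) (val u) => p q l; nra.
  exists (mkcts line_cont); split.
  - move=> _ [u _ <-]; rewrite /sublevel /=; rewrite leNgt; apply/negP => tu.
    move/negP: xy; apply; apply/asboolP; exists (g (line u)) => //.
    have lu := lineE u; have := segment_itv u.
    have [xy|yx] := leP (val x) (val y) => u01; apply/orP; [left|right].
      by rewrite !g_ler// lu; move: (val x) (val y) (val u) xy u01 => p q l; nra.
    by rewrite !g_ler// lu; move: (val x) (val y) (val u) yx u01 => p q l; nra.
  - by apply/val_inj; rewrite lineE /= mul0r addr0.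
  - by apply/val_inj; rewrite lineE /= mul1r addrC subrK.
rewrite (@H0_rank_geP R K _ _ (sublevel (phi \o g) t) _ conn).
- rewrite sepE; split=> [[xs [<- xsA xsP]]|[xs [<- xsA xsP]]].
    exists (map g xs); split; rewrite ?size_map ?pairwise_map//.
    by rewrite all_map; apply/allP => x /xsA /= xs'; rewrite g_itv.
  pose gi v := xget (segment_left ab) [set x | g x = v].
  have giK v : gl <= v <= gr -> g (gi v) = v.
    by move=> /g_surj[x xv]; rewrite /gi; case: xgetP => [y _ //|/(_ x)].
  have giK' : map g (map gi xs) = xs.
    by rewrite -map_comp map_id_in// => v /(allP xsA)/andP[/giK].
  exists (map gi xs); split; first by rewrite size_map.
    move=> _ /mapP[v vxs ->]; have /andP[vlr vs] := allP xsA v vxs.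
    by rewrite /sublevel /= giK.
  by rewrite -pairwise_map giK'.
- by move=> x; rewrite /sublevel /= => /le_trans; apply.
- by move=> x; rewrite /sublevel /conn /= => xt; rewrite sep_irr.
- by move=> x y; rewrite /conn sep_sym.
- move=> y x z; rewrite /conn => xy yz; apply/negP => /(@sep_trans _ _ _ _ (g y)).
  by rewrite (negbTE xy) (negbTE yz).
(* A path in the sublevel set cannot jump over a separating value: [g \o sg] attains it. *)
- move=> sg sgB; rewrite /conn; apply/negP => /asboolP[z zP tz].
  have [||u gu] := @segment_IVT R 0 1 ler01 (g \o sg) z.
  + by move=> u; apply: continuous_comp; [exact: cts_fun|exact: g_cont].
  + rewrite /= ge_min le_max; case/orP: zP => /andP[-> ->]; rewrite ?orbT//.
  have : sublevel (phi \o g) t (sg u) by apply: sgB; exists u.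
  by rewrite /sublevel /= -/((g \o sg) u) gu leNgt tz.
- by move=> x y _ _; exact: paths.
Qed.

(** The bound on [phi] makes [sup] a genuine supremum, so [t < sup] means that some value exceeds
    [t]; by surjectivity of [g] onto [[gl, gr]] this is the test in [prank]. *)
Lemma pers_rankE (M s t : R) : (forall x, `|phi x| < M) -> s < t ->
  pers_rank K (phi \o g) s t = prank phi gl gr s t.
Proof.
move=> phiM st; rewrite /pers_rank /prank.
have -> : (t < sup (range (phi \o g))) = `[< exists2 z, gl <= z <= gr & t < phi z >].
  have ubM : has_sup (range (phi \o g)).
    split; first by exists (phi gl); exists (segment_left ab).
    by exists M => _ [x _ <-] /=; apply/ltW/(le_lt_trans (ler_norm _))/phiM.
  apply/idP/asboolP => [ts|[z /g_surj[x <-] tz]]; last first.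
    by apply: lt_le_trans tz _; apply: ub_le_sup; [exact: ubM.2|exists x].
  apply: contrapT => H; move: ts; apply/negP; rewrite -leNgt.
  apply: ge_sup; first exact: ubM.1.
  move=> _ [x _ <-] /=; rewrite leNgt; apply/negP => tx; apply: H.
  by exists (g x) => //; exact: g_itv.
case: asboolP => // _; rewrite /H0_rank /ncomp; congr xget.
have E m := propext (@H0_rank_ge_comp s t m (ltW st)).
apply/funext => m /=; rewrite E; congr (_ /\ _).
by apply: eq_forall => m'; rewrite E.
Qed.

End ReparametrizedRank.

(** * Atoms of an alternating rank function *)

Section RectangleAtoms.
Context {R : realType}.
Implicit Types (F : R -> R -> int) (a b c d s t : R) (L : seq (R * R)).

(** For a rank function this counts the diagram points in []s, s'] x ]t, t']]. Half-open rectangles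
    tile, so no condition on their boundary is needed. *)
Definition rect_mass F (s s' t t' : R) : int := F s' t - F s t - F s' t' + F s t'.

Definition in_rect (s s' t t' : R) (x : R * R) : bool := (s < x.1 <= s') && (t < x.2 <= t').

(** The point is the infimum of [{u > 0}]; since [u] is constant just to the right of each point,
    the infimum belongs to this set. *)
Lemma first_jump (u : R -> int) a b : a <= b ->
  (forall s, a <= s < b -> \forall s' \near s^'+, u s' = u s) ->
  u a <= 0 -> 0 < u b ->
  exists x, [/\ a < x <= b, 0 < u x & forall s, a <= s < x -> u s <= 0].
Proof.
move=> ab ucont ua ub.
pose S := [set s | a <= s <= b /\ 0 < u s].
have infS : has_inf S.
  by split; [exists b; split; rewrite ?ab ?lexx|exists a => s [/andP[]]].
have ax : a <= inf S by apply: lb_le_inf; [exact: infS.1|move=> s [/andP[]]].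
have xb : inf S <= b by apply: ge_inf; [exact: infS.2|split; rewrite ?ab ?lexx].
have ux : 0 < u (inf S).
  rewrite ltNge; apply/negP => ux.
  have xb' : inf S < b.
    by rewrite lt_neqAle xb andbT; apply/eqP => xbE; move: ub; rewrite ltNge -xbE ux.
  have [|e /= e0 eP] := ucont (inf S); first by rewrite ax.
  have [s [sab us] se] := inf_adherent e0 infS.
  have xs : inf S <= s by apply: ge_inf; [exact: infS.2|].
  have xs' : inf S < s.
    by rewrite lt_neqAle xs andbT; apply/eqP => xsE; move: us; rewrite ltNge -xsE ux.
  have := eP s; rewrite /= ltr0_norm ?subr_lt0// opprB ltrBlDl => /(_ se xs') us'.
  by move: us; rewrite us' ltNge ux.
exists (inf S); split => //.
  rewrite xb andbT lt_neqAle ax andbT; apply/eqP => axE.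
  by move: ux; rewrite ltNge -axE ua.
move=> s /andP[as' sx]; rewrite leNgt; apply/negP => us.
have : inf S <= s by apply: ge_inf; [exact: infS.2|split => //; lra].
by rewrite leNgt sx.
Qed.

(** The function is the rank of an interval module on [[x, y[], whose diagram is the single point
    [(x, y)]. *)
Lemma rect_mass_atom x y s s' t t' : s <= s' -> t <= t' ->
  rect_mass (fun s t => ((x <= s) && (t < y) : nat)%:Z) s s' t t' =
  in_rect s s' t t' (x, y).
Proof.
move=> ss' tt'; rewrite /rect_mass /in_rect /= !ltNge.
have : (x <= s) ==> (x <= s') by apply/implyP => /le_trans; exact.
have : (y <= t) ==> (y <= t') by apply/implyP => /le_trans; exact.
by case: (x <= s) (x <= s') (y <= t) (y <= t') => -[] [] [].
Qed.

(* The points are split off one at a time, each time at a rectangle corner where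
   the mass first becomes positive. *)
Lemma rect_atoms (N : nat) F a b c d : a <= b -> c <= d ->
  (forall s s' t t', a <= s -> s <= s' -> s' <= b -> c <= t -> t <= t' -> t' <= d ->
     0 <= rect_mass F s s' t t') ->
  (forall s t, a <= s < b -> c <= t <= d -> \forall s' \near s^'+, F s' t = F s t) ->
  (forall s t, a <= s <= b -> c <= t < d -> \forall t' \near t^'+, F s t' = F s t) ->
  rect_mass F a b c d = N ->
  exists L, all (in_rect a b c d) L /\
    forall s s' t t', a <= s -> s <= s' -> s' <= b -> c <= t -> t <= t' -> t' <= d ->
     rect_mass F s s' t t' = count (in_rect s s' t t') L.
Proof.
move=> ab cd; elim: N F => [|N IH] F NN RL RR.
  move=> F0; exists [::]; split => //= s s' t t' as_ ss' s'b ct tt' t'd.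
  (* These four rectangles and the given one tile []a, b] x ]c, d]], whose mass is zero; nonnegative
     masses with sum zero all vanish. *)
  have := NN a s c d; have := NN s' b c d; have := NN s s' c t; have := NN s s' t' d.
  have := NN s s' t t'.
  move=> /(_ as_ ss' s'b ct tt' t'd) h0.
  move=> /(_ as_ ss' s'b ltac:(lra) t'd ltac:(lra)) h1.
  move=> /(_ as_ ss' s'b ltac:(lra) ct ltac:(lra)) h2.
  move=> /(_ ltac:(lra) s'b ltac:(lra) ltac:(lra) cd ltac:(lra)) h3.
  move=> /(_ ltac:(lra) as_ ltac:(lra) ltac:(lra) cd ltac:(lra)) h4.
  move: F0 h0 h1 h2 h3 h4; rewrite /rect_mass; clear; lia.
move=> FN.
have [|||x [/andP[ax xb] xpos xmin]] :=
    @first_jump (fun s => rect_mass F a s c d) a b ab.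
- move=> s sab; have h1 := RL s c sab ltac:(lra); have h2 := RL s d sab ltac:(lra).
  near=> s'; rewrite /rect_mass.
  have -> : F s' c = F s c by near: s'; exact: h1.
  by have -> : F s' d = F s d by near: s'; exact: h2.
- by rewrite /rect_mass; lia.
- by rewrite FN.
have [|||y [/andP[cy yd] ypos ymin]] :=
    @first_jump (fun t => rect_mass F a x c t) c d cd.
- move=> t tcd; have h1 := RR a t ltac:(lra) tcd; have h2 := RR x t ltac:(lra) tcd.
  near=> t'; rewrite /rect_mass.
  have -> : F a t' = F a t by near: t'; exact: h1.
  by have -> : F x t' = F x t by near: t'; exact: h2.
- by rewrite /rect_mass; lia.
- by [].
(* Of the positive mass of []a, x] x ]c, y]], nothing lies in []a, s] x ]c, d]] or in []a, x] x ]c,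
   t]], by minimality of [x] and [y]. *)
have atom s t : a <= s < x -> c <= t < y -> 0 < rect_mass F s x t y.
  move=> sx ty; have := xmin s sx; have := ymin t ty; move: ypos.
  have := NN a s y d; have := NN a s c t.
  case/andP: sx => as_ sx; case/andP: ty => ct ty.
  move=> /(_ (lexx a) as_ ltac:(lra) (lexx c) ct ltac:(lra)) h1.
  move=> /(_ (lexx a) as_ ltac:(lra) ltac:(lra) yd (lexx d)) h2.
  by move: h1 h2; rewrite /rect_mass; clear; lia.
(* Subtracting one atom at [(x, y)] keeps masses nonnegative: a rectangle that contains [(x, y)]
   contains one as in [atom], of mass at least 1. *)
pose G s t : int := F s t - ((x <= s) && (t < y) : nat)%:Z.
have massG s s' t t' : s <= s' -> t <= t' ->
    rect_mass G s s' t t' =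
    rect_mass F s s' t t' - (in_rect s s' t t' (x, y) : nat)%:Z.
  move=> ss' tt'; rewrite -rect_mass_atom// /rect_mass /G; clear.
  by do 4!move: (nat_of_bool _) => ?; lia.
have [||||L [LR LE]] := IH G.
- move=> s s' t t' as_ ss' s'b ct tt' t'd; rewrite massG//.
  have Q := NN _ _ _ _ as_ ss' s'b ct tt' t'd.
  case: (boolP (in_rect _ _ _ _ _)); last by rewrite subr0.
  move=> /andP[/andP[/= sx xs'] /andP[/= ty yt']].
  have := atom s t; rewrite as_ ct sx ty => /(_ isT isT).
  have := NN x s' t y; have := NN s s' y t'.
  move=> /(_ as_ ss' s'b (ltW cy) yt' t'd) h1.
  move=> /(_ (ltW ax) xs' s'b ct (ltW ty) yd) h2.
  by move: h1 h2; rewrite /rect_mass; clear; lia.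
- move=> s t sab tcd; have h1 := RL s t sab tcd.
  have h2 : \forall s' \near s^'+, (x <= s') = (x <= s).
    have [xs|sx] := leP x s; near=> s'.
      by rewrite (le_trans xs) //; near: s'; exact: nbhs_right_ge.
    by apply/negbTE; rewrite -ltNge; near: s'; exact: nbhs_right_lt.
  near=> s'; rewrite /G; have -> : F s' t = F s t by near: s'; exact: h1.
  by have -> : (x <= s') = (x <= s) by near: s'; exact: h2.
- move=> s t sab tcd; have h1 := RR s t sab tcd.
  have h2 : \forall t' \near t^'+, (t' < y) = (t < y).
    have [ty|yt] := ltP t y; near=> t'; first by near: t'; exact: nbhs_right_lt.
    by apply/negbTE; rewrite -leNgt (le_trans yt) //; near: t'; exact: nbhs_right_ge.
  near=> t'; rewrite /G; have -> : F s t' = F s t by near: t'; exact: h1.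
  by have -> : (t' < y) = (t < y) by near: t'; exact: h2.
- have xyR : in_rect a b c d (x, y) by rewrite /in_rect /= ax xb cy.
  by apply/eqP; rewrite massG// FN xyR subr_eq -PoszD addn1.
exists ((x, y) :: L); split; first by rewrite /= LR /in_rect /= ax xb cy yd.
move=> s s' t t' as_ ss' s'b ct tt' t'd /=.
have /eqP := LE s s' t t' as_ ss' s'b ct tt' t'd.
by rewrite massG// subr_eq addrC PoszD => /eqP.
Unshelve. all: by end_near. Qed.

End RectangleAtoms.

(** * Existence and uniqueness of the diagram of a rank function *)

Section RankFunction.
Context {R : realType}.
Implicit Types (r : R -> R -> nat) (m : R * R -> nat) (x y : R * R)
  (a b c d s t e M : R) (L : seq (R * R)).

Record rank_function M r : Prop := RankFunction {
  rank_alternating : forall s s' t t', s <= s' -> s' < t -> t <= t' ->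
    (r s t + r s' t' <= r s' t + r s t')%N ;
  rank_contl : forall s t, s < t -> \forall s' \near s^'+, r s' t = r s t ;
  rank_contr : forall s t, s < t -> \forall t' \near t^'+, r s t' = r s t ;
  rank_out : forall s t, s <= - M \/ M <= t -> r s t = 0%N
}.

Definition mass r s s' t t' : int := rect_mass (fun s t => r s t : int) s s' t t'.

Definition atoms r a b c d L : Prop := all (in_rect a b c d) L /\
  forall s s' t t', a <= s -> s <= s' -> s' <= b -> c <= t -> t <= t' -> t' <= d ->
    mass r s s' t t' = count (in_rect s s' t t') L.

Lemma atoms_exist M r a b c d : rank_function M r -> a <= b -> b < c -> c <= d ->
  exists L, atoms r a b c d L.
Proof.
move=> [alt contl contr _] ab bc cd.
have NN s s' t t' : a <= s -> s <= s' -> s' <= b -> c <= t -> t <= t' -> t' <= d ->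
    0 <= mass r s s' t t'.
  move=> as_ ss' s'b ct tt' t'd.
  have := alt s s' t t' ss' (le_lt_trans s'b (lt_le_trans bc ct)) tt'.
  by rewrite /mass /rect_mass; clear; lia.
have [N NE] : exists N : nat, mass r a b c d = N.
  exists `|mass r a b c d|%N; rewrite gez0_abs//.
  exact: NN (lexx _) ab (lexx _) (lexx _) cd (lexx _).
apply: (@rect_atoms _ N) => //.
- move=> s t /andP[as_ sb] /andP[ct td].
  have st : s < t by lra.
  by near=> s'; congr Posz; near: s'; exact: contl.
- move=> s t /andP[as_ sb] /andP[ct td].
  have st : s < t by lra.
  by near=> t'; congr Posz; near: t'; exact: contr.
Unshelve. all: by end_near. Qed.

Lemma near_isolated L x :
  \forall e \near (0 : R)^'+, forall y, y \in L -> `|x - y| <= e -> y = x.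
Proof.
apply: (near_all_mem (P := fun y e => `|x - y| <= e -> y = x)) => y yL.
have [->|yx] := eqVneq y x; first exact: nearW.
have xy0 : 0 < `|x - y| by rewrite normr_gt0 subr_eq0 eq_sym.
near=> e => /le_lt_trans xye; exfalso.
have : e < `|x - y| by near: e; exact: nbhs_right_lt.
by move=> /xye; rewrite ltxx.
Unshelve. all: by end_near. Qed.

Lemma pair_norm_le x y e : (`|x - y| <= e) = (`|x.1 - y.1| <= e) && (`|x.2 - y.2| <= e).
Proof. by rewrite [`|_|]prod_normE /= ge_max. Qed.

(** A small half-open square with upper right corner [x] contains no other atom. The multiplicity of
    [x] is thus read off [r], independently of the rectangle. *)
Lemma atoms_near r a b c d L x : atoms r a b c d L -> in_rect a b c d x ->
  \forall e \near (0 : R)^'+,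
    mass r (x.1 - e) x.1 (x.2 - e) x.2 = count_mem x L.
Proof.
move=> [LR LE] /andP[/andP[ax xb] /andP[cx xd]].
near=> e.
have e0 : 0 < e by near: e; exact: nbhs_right_gt.
have ea : e < x.1 - a by near: e; apply: nbhs_right_lt; rewrite subr_gt0.
have ec : e < x.2 - c by near: e; apply: nbhs_right_lt; rewrite subr_gt0.
rewrite LE //; [|lra..].
congr Posz; apply: eq_in_count => y yL; apply/idP/eqP => [|->].
  move=> /andP[y1 y2].
  have iso : forall y, y \in L -> `|x - y| <= e -> y = x.
    by near: e; exact: near_isolated.
  apply: iso => //; rewrite pair_norm_le !ger0_norm ?subr_ge0; lra.
by rewrite /in_rect !lexx !andbT !ltrBlDr !ltrDl e0.
Unshelve. all: by end_near. Qed.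

Lemma atoms_eq r a b c d L a' b' c' d' L' x :
  atoms r a b c d L -> in_rect a b c d x ->
  atoms r a' b' c' d' L' -> in_rect a' b' c' d' x ->
  count_mem x L = count_mem x L'.
Proof.
move=> LA xL LA' xL'.
near (0 : R)^'+ => e; apply/eqP; rewrite -eqz_nat.
have <- : mass r (x.1 - e) x.1 (x.2 - e) x.2 = count_mem x L.
  by near: e; exact: atoms_near xL.
apply/eqP; near: e; exact: atoms_near xL'.
Unshelve. all: by end_near. Qed.

(** At [r := pers_rank K h] this is convertible to [is_offdiagonal_diagram K h]. *)
Definition is_diagram r m : Prop :=
  [/\ forall x, m x != 0%N -> halfplane x,
      forall x, halfplane x ->
        exists2 U, nbhs x U & finite_set (U `&` [set y | m y != 0%N]) &
      forall a b c d, a < b -> b < c -> c < d ->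
        (forall x, rect_boundary a b c d x -> m x = 0%N) ->
        (\big[addn/0%N]_(x \in rect a b c d) m x)%:Z =
          (r b c)%:Z - (r a c)%:Z - (r b d)%:Z + (r a d)%:Z].

Lemma fsbig_count_mem (A : set (R * R)) L : (forall x, x \in L -> A x) ->
  \big[addn/0%N]_(x \in A) count_mem x L = size L.
Proof.
move=> LA; rewrite (fsbigE (undup L)) ?undup_uniq//=.
- rewrite -sum1_size -[RHS]big_undup_iterop_count /=.
  rewrite big_seq_cond [RHS]big_seq_cond; apply: eq_big => y.
    by rewrite mem_undup; case: (boolP (y \in L)) => //= /LA/mem_set ->.
  by rewrite Monoid.iteropE iter_addn_0 mul1n.
- by move=> x /=; rewrite mem_undup; exact: LA.
- by move=> x _; rewrite mem_undup => /count_memPn.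
Qed.

Lemma mass_out M r s s' t t' : rank_function M r -> s <= s' -> t <= t' ->
  s' <= - M \/ M <= t -> mass r s s' t t' = 0.
Proof.
move=> rf ss' tt' H; rewrite /mass /rect_mass.
by case: H => ?; rewrite !(rank_out rf)//; ((left; lra) || (right; lra)).
Qed.

(** Multiplicities are defined by the atoms of a rectangle around each point above the diagonal; by
    [atoms_eq] any other rectangle gives the same value. *)
Lemma diagram_exists M r : rank_function M r ->
  exists m, [/\ is_diagram r m,
    forall a b c d L x, b < c -> atoms r a b c d L -> in_rect a b c d x ->
      m x = count_mem x L &
    forall x, x.1 <= - M \/ M < x.2 -> m x = 0%N].
Proof.
move=> rf.
(* The points that cut [[x.1, x.2]] in three, so that the rectangle up to [B1 x] and from [B2 x] on
   contains [x] in its interior and stays above the diagonal. *)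
pose B1 x : R := (2 * x.1 + x.2) / 3; pose B2 x : R := (x.1 + 2 * x.2) / 3.
have BP x : x.1 < x.2 -> [/\ x.1 - 1 < x.1, x.1 < B1 x, B1 x < B2 x, B2 x < x.2 & x.2 < x.2 + 1].
  by move=> ?; rewrite /B1 /B2; split; lra.
have /choice[Lf LfP] : forall x, exists L, x.1 < x.2 ->
    atoms r (x.1 - 1) (B1 x) (B2 x) (x.2 + 1) L.
  move=> x; have [xh|xh] := ltP x.1 x.2; last by exists [::].
  have [h1 h2 h3 h4 h5] := BP x xh.
  by have [|||L LP] := @atoms_exist M r (x.1 - 1) (B1 x) (B2 x) (x.2 + 1) rf;
    [lra|lra|lra|exists L].
have xB x : x.1 < x.2 -> in_rect (x.1 - 1) (B1 x) (B2 x) (x.2 + 1) x.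
  by move=> /BP[h1 h2 h3 h4 h5]; rewrite /in_rect; lra.
pose m x := if x.1 < x.2 then count_mem x (Lf x) else 0%N.
have mE a b c d L x : b < c -> atoms r a b c d L -> in_rect a b c d x -> m x = count_mem x L.
  move=> bc LA xL; have xh : x.1 < x.2.
    by case/andP: xL => /andP[? ?] /andP[? ?]; lra.
  by rewrite /m xh; apply: atoms_eq (LfP _ xh) (xB _ xh) LA xL.
exists m; split => //.
- split.
  + by move=> x; rewrite /m; case: ifP.
  + move=> x xh; have [h1 h2 h3 h4 h5] := BP x xh.
    exists [set y | (x.1 - 1 < y.1 < B1 x) && (B2 x < y.2 < x.2 + 1)].
      exists (`]x.1 - 1, B1 x[%classic, `]B2 x, x.2 + 1[%classic).
        split; apply: open_nbhs_nbhs; split; try exact: itv_open.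
          by rewrite /= in_itv /= h1.
        by rewrite /= in_itv /= h4.
      by move=> y [] /=; rewrite !in_itv /= => -> ->.
    apply: (@sub_finite_set _ _ [set` Lf x]); last exact: finite_seq.
    move=> y [/andP[/andP[y1 y2] /andP[y3 y4]] /= my].
    have yB : in_rect (x.1 - 1) (B1 x) (B2 x) (x.2 + 1) y by rewrite /in_rect; lra.
    apply: contrapT => /negP yL; move: my.
    by rewrite (mE _ _ _ _ _ _ h3 (LfP _ xh) yB) (count_memPn yL).
  + move=> a b c d ab bc cd bd0.
    have [L LA] := atoms_exist rf (ltW ab) bc (ltW cd).
    have [/allP LR LE] := LA.
    (* The closed rectangle exceeds the half-open one only by boundary points, where [m] is zero by
       hypothesis and [L] has no member. *)
    rewrite (eq_fsbigr (fun x => count_mem x L)); last first.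
      move=> x; rewrite inE => xR.
      have [xh|xh] := boolP (in_rect a b c d x); first exact: mE bc LA xh.
      rewrite bd0; first by apply/esym/count_memPn/negP => /LR; rewrite (negbTE xh).
      split => // -[/=]; rewrite !in_itv /= => x1 x2.
      by move/negP: xh; apply; rewrite /in_rect; lra.
    rewrite fsbig_count_mem; last first.
      by move=> x /LR; rewrite /in_rect /rect /= !in_itv /=; lra.
    have -> : size L = count (in_rect a b c d) L.
      by apply/esym/eqP; rewrite -all_count; apply/allP.
    rewrite -LE ?lexx ?ltW// /mass /rect_mass; clear; lia.
- move=> x H; rewrite /m; case: ifP => // xh.
  (* The strict inequality [M < x.2] leaves room for the lower side [x.2 - e] of the small square to
     be at least [M]. *)
  have NM : \forall e \near (0 : R)^'+, x.1 <= - M \/ M <= x.2 - e.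
    case: H => [?|Mx]; first by apply: nearW => e; left.
    near=> e; right.
    have : e < x.2 - M by near: e; apply: nbhs_right_lt; rewrite subr_gt0.
    lra.
  near (0 : R)^'+ => e; apply/eqP; rewrite -eqz_nat; apply/eqP.
  have <- : mass r (x.1 - e) x.1 (x.2 - e) x.2 = count_mem x (Lf x).
    by near: e; exact: atoms_near (LfP _ xh) (xB _ xh).
  have e0 : 0 < e by near: e; exact: nbhs_right_gt.
  apply: (mass_out rf); [lra|lra|].
  by near: e.
Unshelve. all: by end_near. Qed.

(** By local finiteness a small closed square around [x] contains no other point of either multiset.
    Its boundary is then free of points, and both multiplicities equal the same alternating sum. *)
Lemma diagram_unique r m m' : is_diagram r m -> is_diagram r m' -> m = m'.
Proof.
move=> [mh mf mr] [mh' mf' mr']; apply/funext => x.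
have [xh|xh] := pselect (halfplane x); last first.
  by move: (mh x) (mh' x); case: (m x) => [|?]; case: (m' x) => [|?] //= H1 H2;
    exfalso; apply: xh; first [exact: H1|exact: H2].
have [U Ux /finite_seqP[s sE]] := mf x xh.
have [U' Ux' /finite_seqP[s' sE']] := mf' x xh.
have [e1 /= e10 eU] := (@nbhs_normP R (R * R)%type x (U `&` U')).1 (filterI Ux Ux').
near (0 : R)^'+ => e.
have e0 : 0 < e by near: e; exact: nbhs_right_gt.
have ee1 : e < e1 by near: e; exact: nbhs_right_lt.
have ex : e < (x.2 - x.1) / 2.
  by near: e; apply: nbhs_right_lt; rewrite divr_gt0// subr_gt0.
have iso : forall y, y \in s ++ s' -> `|x - y| <= e -> y = x.
  by near: e; exact: near_isolated.
pose Q := rect (x.1 - e) (x.1 + e) (x.2 - e) (x.2 + e).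
have QP y : Q y -> `|x - y| <= e.
  rewrite /Q /rect /= !in_itv /= => -[y1 y2].
  by rewrite pair_norm_le !ler_distl; lra.
have Qx : Q x by rewrite /Q /rect /= !in_itv /=; lra.
have mQ y : Q y -> y <> x -> m y = 0%N.
  move=> /QP xy yx; apply/eqP; apply: contrapT => /negP my; apply: yx; apply: iso => //.
  rewrite mem_cat; apply/orP; left.
  have : [set` s] y by rewrite -sE; split => //; apply: (eU _ _).1; exact: le_lt_trans xy ee1.
  by [].
have mQ' y : Q y -> y <> x -> m' y = 0%N.
  move=> /QP xy yx; apply/eqP; apply: contrapT => /negP my; apply: yx; apply: iso => //.
  rewrite mem_cat; apply/orP; right.
  have : [set` s'] y by rewrite -sE'; split => //; apply: (eU _ _).2; exact: le_lt_trans xy ee1.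
  by [].
have bdy y : rect_boundary (x.1 - e) (x.1 + e) (x.2 - e) (x.2 + e) y -> Q y /\ y <> x.
  move=> [Qy nQ]; split => // yx; apply: nQ; rewrite yx /= !in_itv /=; lra.
have sumQ (f : R * R -> nat) : (forall y, Q y -> y <> x -> f y = 0%N) ->
    \big[addn/0%N]_(y \in Q) f y = f x.
  move=> f0; transitivity (\big[addn/0%N]_(y \in [set x]) f y); last exact: fsbig_set1.
  apply/esym/fsbig_widen; first by move=> y ->.
  by move=> y [Qy yx]; apply: f0.
apply/eqP; rewrite -eqz_nat -(sumQ _ mQ) -(sumQ _ mQ').
rewrite mr; [|lra|lra|lra|by move=> y /bdy[Qy yx]; exact: mQ].
by rewrite mr'; [|lra|lra|lra|by move=> y /bdy[Qy yx]; exact: mQ'].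
Unshelve. all: by end_near. Qed.

End RankFunction.

(** * Sums over the diagram as limits of Riemann sums *)

Section DiagramSum.
Context {R : realType}.
Implicit Types (r : R -> R -> nat) (m : R * R -> nat) (x y : R * R)
  (a b c d s t e M : R) (L : seq (R * R)) (f : R * R -> R).

Definition dsum m f : R :=
  fine (\sum_(x \in [set: R * R])
    ((if x.1 == x.2 then +oo else (m x)%:R%:E) * (f x)%:E))%E.

Definition the_diagram r : R * R -> nat := xget (fun=> 0%N) (is_diagram r).

Lemma the_diagramE r m : is_diagram r m -> the_diagram r = m.
Proof.
move=> rm; rewrite /the_diagram; case: xgetP => [m' _ rm'|/(_ m)//].
exact: diagram_unique rm' rm.
Qed.

Lemma sum_undup (I : eqType) (s : seq I) (g : I -> R) :
  \sum_(i <- undup s) (count_mem i s)%:R * g i = \sum_(i <- s) g i.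
Proof.
rewrite -[RHS]big_undup_iterop_count; apply: eq_bigr => i _.
by rewrite mulr_natl.
Qed.

Lemma dsum_seq m f L : (forall x, x.1 = x.2 -> f x = 0) ->
  (forall x, f x != 0 -> m x = count_mem x L) ->
  dsum m f = \sum_(x <- L) f x.
Proof.
move=> f0 mL; rewrite /dsum.
have mf x : (m x)%:R * f x = (count_mem x L)%:R * f x.
  by have [->|/mL ->//] := eqVneq (f x) 0; rewrite !mulr0.
rewrite (eq_fsbigr (fun x => ((count_mem x L)%:R * f x)%:E)); last first.
  move=> x _; case: eqP => [/f0->|_]; first by rewrite mule0 mulr0.
  by rewrite -EFinM mf.
rewrite (fsbigE (undup L)) ?undup_uniq//; last first.
  by move=> x _; rewrite mem_undup => /count_memPn ->; rewrite mul0r.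
rewrite sumEFin /= -sum_undup.
by apply: eq_bigl => x; exact: mem_set.
Qed.

Lemma count_steps a e s (N : nat) : 0 <= e ->
  (\sum_(0 <= i < N) ((a + i%:R * e < s <= a + i.+1%:R * e)%R : nat) =
   ((a < s <= a + N%:R * e)%R : nat))%N.
Proof.
move=> e0; elim: N => [|N IH].
  by rewrite big_nil mul0r addr0; case: ltP => //= as_; rewrite leNgt as_.
rewrite big_nat_recr//= {}IH.
have h1 : a <= a + N%:R * e by rewrite lerDl mulr_ge0.
have h2 : a + N%:R * e <= a + N.+1%:R * e by rewrite lerD2l ler_wpM2r// ler_nat.
case: (ltP a s) => sa; case: (ltP (a + N%:R * e) s) => sb //=.
- by rewrite (le_trans sb h2).
- by exfalso; lra.
Qed.

Section Strips.
Variables (M eps : R) (N : nat).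

(** Strip [i] has abscissas up to [strip_a i.+1] and ordinates above [strip_a i.+2]. The gap
    [eps / 3] keeps it off the diagonal, and a point with such an abscissa and persistence above
    [eps] has its ordinate above [strip_a i.+3]. *)
Definition strip_a (i : nat) : R := - M + i%:R * (eps / 3).
Definition strip_d : R := - M + (N.+2)%:R * (eps / 3).

(** Points of persistence at most [eps] contribute nothing, and every other diagram point lies in
    exactly one strip. *)
Lemma dsum_strips r f (Ls : nat -> seq (R * R)) : rank_function M r -> 0 < eps ->
  2 * M <= N%:R * (eps / 3) ->
  (forall x, x.2 - x.1 <= eps -> f x = 0) ->
  (forall i, (i < N)%N ->
    atoms r (strip_a i) (strip_a i.+1) (strip_a i.+2) strip_d (Ls i)) ->
  dsum (the_diagram r) f = \sum_(0 <= i < N) \sum_(x <- Ls i) f x.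
Proof.
move=> rf eps0 NM f0 LsP.
have [m [mD mE mout]] := diagram_exists rf; rewrite (the_diagramE mD).
have e30 : 0 < eps / 3 by rewrite divr_gt0.
pose LL := flatten [seq Ls i | i <- iota 0 N].
rewrite (dsum_seq (L := LL)).
- by rewrite big_flatten big_map /index_iota subn0.
- by move=> x x12; apply: f0; rewrite x12 subrr ltW.
move=> x fx.
have xeps : eps < x.2 - x.1.
  by rewrite ltNge; apply/negP => /f0 fx0; rewrite fx0 eqxx in fx.
have stripS i : strip_a i.+1 = strip_a i + eps / 3.
  by rewrite /strip_a -natr1 mulrDl mul1r addrA.
have cnt i : (i < N)%N ->
    count_mem x (Ls i) = (m x * ((strip_a i < x.1 <= strip_a i.+1)%R : nat))%N.
  move=> iN; have [/allP LsR _] := LsP _ iN.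
  have [/andP[x1 x2]|x1] := boolP (strip_a i < x.1 <= strip_a i.+1); last first.
    rewrite muln0; apply/count_memPn/negP => /LsR /andP[].
    by rewrite (negbTE x1).
  have [xd|dx] := leP x.2 strip_d.
    rewrite muln1; apply/esym; apply: (mE _ _ _ _ _ _ _ (LsP _ iN)).
      by rewrite [X in _ < X]stripS ltrDl.
    rewrite /in_rect x1 x2 xd andbT /=; move: x2; rewrite !stripS; lra.
  (* The choice of [N] puts [strip_d] above [M], beyond which the diagram is empty. *)
  rewrite mout; last first.
    by right; move: dx; rewrite /strip_d -addn2 natrD mulrDl; lra.
  by apply/count_memPn/negP => /LsR /andP[_ /andP[_]]; rewrite leNgt dx.
rewrite count_flatten -map_comp sumnE big_map.
have -> : (\sum_(i <- iota 0 N) count_mem x (Ls i) =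
    \sum_(0 <= i < N) m x * ((strip_a i < x.1 <= strip_a i.+1)%R : nat))%N.
  rewrite /index_iota subn0 big_seq [RHS]big_seq; apply: eq_bigr => i.
  by rewrite mem_iota => /cnt.
rewrite -big_distrr/= count_steps; last exact: ltW.
have [x1|x1] := leP x.1 (- M); first by rewrite mout ?mul0n//; left.
have [x2|x2] := ltP M x.2; first by rewrite mout ?mul0n//; right.
by rewrite (_ : x.1 <= _) ?muln1//; lra.
Qed.

End Strips.

Definition riemann r f a b c d (n : nat) : R :=
  \sum_(0 <= i < n) \sum_(0 <= j < n)
    (mass r (a + i%:R * ((b - a) / n%:R)) (a + i.+1%:R * ((b - a) / n%:R))
            (c + j%:R * ((d - c) / n%:R)) (c + j.+1%:R * ((d - c) / n%:R)))%:~R *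
    f (a + i.+1%:R * ((b - a) / n%:R), c + j.+1%:R * ((d - c) / n%:R)).

(** Exactly one cell of the grid contains [x], and its upper right corner tends to [x] as the mesh
    shrinks. *)
Lemma grid_cvg f a b c d x : continuous f -> a <= b -> c <= d -> in_rect a b c d x ->
  (fun n : nat => \sum_(0 <= i < n) \sum_(0 <= j < n)
    (in_rect (a + i%:R * ((b - a) / n%:R)) (a + i.+1%:R * ((b - a) / n%:R))
            (c + j%:R * ((d - c) / n%:R)) (c + j.+1%:R * ((d - c) / n%:R)) x : nat)%:R *
    f (a + i.+1%:R * ((b - a) / n%:R), c + j.+1%:R * ((d - c) / n%:R)))
    @ \oo --> f x.
Proof.
move=> cf ab cd /andP[xab xcd].
apply/cvgrPdist_le => e e0.
have /cvgrPdist_le/(_ _ e0) := cf x.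
move=> /(@nbhs_normP R (R * R)%type)[del /= del0 delP].
have near_small u : 0 <= u -> \forall n \near \oo, u / n%:R < del.
  move=> u0; near=> n.
  have n0 : (0 < n)%N by near: n; exact: nbhs_infty_gt.
  rewrite ltr_pdivrMr ?ltr0n// mulrC -ltr_pdivrMr//.
  by near: n; exact: nbhs_infty_gtr.
near=> n.
have n0 : (0 < n)%N by near: n; exact: nbhs_infty_gt.
have n0' : n%:R != 0 :> R by rewrite pnatr_eq0 -lt0n.
have uab : (b - a) / n%:R < del by near: n; apply: near_small; rewrite subr_ge0.
have ucd : (d - c) / n%:R < del by near: n; apply: near_small; rewrite subr_ge0.
have u0 : 0 <= (b - a) / n%:R by rewrite divr_ge0// subr_ge0.
have v0 : 0 <= (d - c) / n%:R by rewrite divr_ge0// subr_ge0.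
have ub : a + n%:R * ((b - a) / n%:R) = b by rewrite mulrC divfK// addrC subrK.
have vd : c + n%:R * ((d - c) / n%:R) = d by rewrite mulrC divfK// addrC subrK.
move: ((b - a) / n%:R) ((d - c) / n%:R) u0 v0 ub vd uab ucd => u v u0 v0 ub vd uab ucd.
pose I i j : R := (in_rect (a + i%:R * u) (a + i.+1%:R * u)
  (c + j%:R * v) (c + j.+1%:R * v) x : nat)%:R.
have I0 i j : 0 <= I i j by rewrite ler0n.
have I1 : \sum_(0 <= i < n) \sum_(0 <= j < n) I i j = 1.
  rewrite (eq_bigr (fun i => ((a + i%:R * u < x.1 <= a + i.+1%:R * u)%R : nat)%:R)).
    by rewrite -natr_sum count_steps// ub xab.
  move=> i _; rewrite (eq_bigr (fun j =>
      ((a + i%:R * u < x.1 <= a + i.+1%:R * u)%R : nat)%:R *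
      ((c + j%:R * v < x.2 <= c + j.+1%:R * v)%R : nat)%:R)).
    by rewrite -big_distrr /= -natr_sum count_steps// vd xcd mulr1.
  by move=> j _; rewrite /I /in_rect -natrM mulnb.
have -> : f x = (\sum_(0 <= i < n) \sum_(0 <= j < n) I i j) * f x.
  by rewrite I1 mul1r.
rewrite mulr_suml -sumrB.
apply: (@le_trans _ _ (\sum_(0 <= i < n) \sum_(0 <= j < n) I i j * e)); last first.
  under eq_bigr do rewrite -mulr_suml.
  by rewrite -mulr_suml I1 mul1r.
apply: le_trans (ler_norm_sum _ _ _) _; apply: ler_sum => i _.
rewrite mulr_suml -sumrB.
apply: le_trans (ler_norm_sum _ _ _) _; apply: ler_sum => j _.
rewrite -[X in _ - X * _]/(I i j) -mulrBr normrM (ger0_norm (I0 i j)).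
rewrite /I; case: (boolP (in_rect _ _ _ _ _)) => [/andP[x1 x2]|_]; last by rewrite !mul0r.
rewrite !mul1r; apply: delP => /=.
rewrite [`|_|]prod_normE /= gt_max; apply/andP; split; rewrite ltr_distl.
  move: x1; rewrite -natr1 mulrDl mul1r; lra.
move: x2; rewrite -natr1 mulrDl mul1r; lra.
Unshelve. all: by end_near. Qed.

(** The mass of a cell is its number of atoms, so the Riemann sum splits into one grid sum per
    atom. *)
Lemma riemann_cvg r f a b c d L : continuous f -> a <= b -> c <= d ->
  atoms r a b c d L -> riemann r f a b c d n @[n --> \oo] --> \sum_(x <- L) f x.
Proof.
move=> cf ab cd [/allP LR LE].
pose G x (n : nat) := \sum_(0 <= i < n) \sum_(0 <= j < n)
    (in_rect (a + i%:R * ((b - a) / n%:R)) (a + i.+1%:R * ((b - a) / n%:R))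
            (c + j%:R * ((d - c) / n%:R)) (c + j.+1%:R * ((d - c) / n%:R)) x : nat)%:R *
    f (a + i.+1%:R * ((b - a) / n%:R), c + j.+1%:R * ((d - c) / n%:R)).
have riemannE n : riemann r f a b c d n = \sum_(x <- L) G x n.
  rewrite exchange_big /=; apply: eq_big_nat => i /andP[_ iN].
  rewrite exchange_big /=; apply: eq_big_nat => j /andP[_ jN].
  have n0 : n%:R != 0 :> R by rewrite pnatr_eq0 -lt0n (leq_ltn_trans _ iN).
  have u0 : 0 <= (b - a) / n%:R by rewrite divr_ge0// subr_ge0.
  have v0 : 0 <= (d - c) / n%:R by rewrite divr_ge0// subr_ge0.
  have ub : a + n%:R * ((b - a) / n%:R) = b by rewrite mulrC divfK// addrC subrK.
  have vd : c + n%:R * ((d - c) / n%:R) = d by rewrite mulrC divfK// addrC subrK.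
  move: ((b - a) / n%:R) ((d - c) / n%:R) u0 v0 ub vd => u v u0 v0 ub vd.
  rewrite -mulr_suml LE.
  - by congr (_ * _); rewrite -natr_sum -sum1_count big_mkcond.
  - by rewrite lerDl mulr_ge0.
  - by rewrite lerD2l ler_wpM2r// ler_nat.
  - by rewrite -[X in _ <= X]ub lerD2l ler_wpM2r// ler_nat.
  - by rewrite lerDl mulr_ge0.
  - by rewrite lerD2l ler_wpM2r// ler_nat.
  - by rewrite -[X in _ <= X]vd lerD2l ler_wpM2r// ler_nat.
rewrite big_seq (_ : riemann r f a b c d = fun n => \sum_(x <- L | x \in L) G x n).
  apply: (cvg_big (op := +%R)) => [|x xL]; first exact: add_continuous.
  by apply: grid_cvg => //; exact: LR.
by apply/funext => n; rewrite riemannE big_seq.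
Qed.

End DiagramSum.

(** * Measurability *)

Section MeasurableDiagramSum.
Context {R : realType} (d : measure_display) (Omega : measurableType d).

Lemma measurable_natr_of_lt (N : Omega -> nat) :
  (forall m, measurable [set w | (m < N w)%N]) ->
  measurable_fun setT (fun w => (N w)%:R : R).
Proof.
move=> mN _ Y _; rewrite setTI.
have mE m : measurable [set w | N w = m].
  case: m => [|m].
    rewrite (_ : [set _ | _] = ~` [set w | (0 < N w)%N]); first exact: measurableC.
    by apply/seteqP; split => w /=; [move=> ->|move/negP; rewrite -eqn0Ngt => /eqP].
  rewrite (_ : [set _ | _] = [set w | (m < N w)%N] `\` [set w | (m.+1 < N w)%N]).
    exact: measurableD.
  apply/seteqP; split => w /=; first by move=> ->; rewrite ltnn ltnSn.
  by move=> [mN' /negP]; rewrite -leqNgt => Nm; apply/eqP; rewrite eqn_leq Nm mN'.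
rewrite (_ : _ @^-1` _ = \bigcup_(m in [set m | Y m%:R]) [set w | N w = m]).
  by apply: bigcup_measurable.
apply/seteqP; split => w /=; first by exists (N w).
by move=> [m /= Ym ->].
Qed.

Lemma measurable_sum_mem (I : eqType) (s : seq I) (h : I -> Omega -> R) :
  (forall i, i \in s -> measurable_fun setT (h i)) ->
  measurable_fun setT (fun w => \sum_(i <- s) h i w).
Proof.
elim: s => [_|i s IH mh].
  by under eq_fun do rewrite big_nil; exact: measurable_cst.
under eq_fun do rewrite big_cons; apply: measurable_funD.
  by apply: mh; rewrite mem_head.
by apply: IH => j js; apply: mh; rewrite inE js orbT.
Qed.

(** The Riemann sums involve only masses, which are measurable in [w]. The lists [Ls w] are chosen
    without any measurability and serve to identify the pointwise limit. *)
Lemma measurable_dsum (r : Omega -> R -> R -> nat) (M eps : R) (f : R * R -> R) :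
  (forall w, rank_function M (r w)) ->
  (forall s t, s < t -> measurable_fun setT (fun w => (r w s t)%:R : R)) ->
  0 < eps -> continuous f -> (forall x, x.2 - x.1 <= eps -> f x = 0) ->
  measurable_fun setT (fun w => dsum (the_diagram (r w)) f).
Proof.
move=> rf mr eps0 cf f0.
have e30 : 0 < eps / 3 by rewrite divr_gt0.
have [N NM] : exists N : nat, 2 * M <= N%:R * (eps / 3).
  exists (Num.truncn (2 * M / (eps / 3))).+1.
  by rewrite -ler_pdivrMr// ltW// truncnS_gt.
have stripS i : strip_a M eps i.+1 = strip_a M eps i + eps / 3.
  by rewrite /strip_a -natr1 mulrDl mul1r addrA.
have strip_le i : (i < N)%N -> strip_a M eps i.+2 <= strip_d M eps N.
  by move=> iN; rewrite /strip_a /strip_d lerD2l (ler_wpM2r (ltW e30))// ler_nat !ltnS ltnW.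
have /choice[Ls LsP] : forall w, exists Ls : nat -> seq (R * R),
    forall i, (i < N)%N -> atoms (r w) (strip_a M eps i) (strip_a M eps i.+1)
      (strip_a M eps i.+2) (strip_d M eps N) (Ls i).
  move=> w; suff /choice[Ls LsP] : forall i, exists L, (i < N)%N ->
      atoms (r w) (strip_a M eps i) (strip_a M eps i.+1) (strip_a M eps i.+2)
        (strip_d M eps N) L by exists Ls.
  move=> i; have [iN|] := ltnP i N; last by exists [::].
  have [|||L LP] := atoms_exist (rf w) (a := strip_a M eps i) (b := strip_a M eps i.+1)
    (c := strip_a M eps i.+2) (d := strip_d M eps N).
  - by rewrite stripS lerDl ltW.
  - by rewrite [X in _ < X]stripS ltrDl.
  - exact: strip_le.
  by exists L.
apply: (@measurable_fun_cvg _ _ _ setT (fun n w => \sum_(0 <= i < N)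
    riemann (r w) f (strip_a M eps i) (strip_a M eps i.+1) (strip_a M eps i.+2)
      (strip_d M eps N) n)); last first.
  move=> w _; rewrite (dsum_strips (rf w) eps0 NM f0 (LsP w)).
  rewrite [X in _ --> X]big_seq /=.
  under [X in X @ _]eq_fun do rewrite big_seq.
  apply: (cvg_big (op := +%R)) => [|i]; first exact: add_continuous.
  rewrite mem_index_iota => /andP[_ iN].
  by apply: riemann_cvg => //; [rewrite stripS lerDl ltW|exact: strip_le|exact: LsP].
(* The condition [s' < t] keeps all four corners above the diagonal, where [mr] applies; the gap
   built into the strips provides it. *)
have meas s s' t t' : s <= s' -> s' < t -> t <= t' ->
    measurable_fun setT (fun w => (mass (r w) s s' t t')%:~R : R).
  move=> ss' s't tt'; rewrite /mass /rect_mass.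
  under eq_fun do rewrite !intrD !mulrNz -!pmulrn.
  by apply: measurable_funD; [apply: measurable_funB; [apply: measurable_funB|]|];
    apply: mr; lra.
move=> n; apply: measurable_sum_mem => i; rewrite mem_index_iota => /andP[_ iN].
apply: measurable_sum_mem => j; rewrite mem_index_iota => /andP[_ jn].
apply: measurable_sum_mem => l; rewrite mem_index_iota => /andP[_ ln].
apply: measurable_funM; last exact: measurable_cst.
have n0 : n%:R != 0 :> R by rewrite pnatr_eq0 -lt0n (leq_ltn_trans _ jn).
have bd (a b : R) k : a <= b -> (k <= n)%N -> a <= a + k%:R * ((b - a) / n%:R) <= b.
  move=> ab kn.
  have u0 : 0 <= (b - a) / n%:R by rewrite divr_ge0// subr_ge0.
  have ub : a + n%:R * ((b - a) / n%:R) = b by rewrite mulrC divfK// addrC subrK.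
  by rewrite lerDl mulr_ge0//= -[X in _ <= X]ub lerD2l ler_wpM2r// ler_nat.
have step (a b : R) k : a <= b -> a + k%:R * ((b - a) / n%:R) <= a + k.+1%:R * ((b - a) / n%:R).
  by move=> ab; rewrite lerD2l ler_wpM2r ?ler_nat// divr_ge0// subr_ge0.
have sab : strip_a M eps i <= strip_a M eps i.+1 by rewrite stripS lerDl ltW.
have sbc : strip_a M eps i.+1 < strip_a M eps i.+2 by rewrite [X in _ < X]stripS ltrDl.
have scd := strip_le _ iN.
apply: meas; [exact: step| |exact: step].
have /andP[_ h1] := bd _ _ _ sab jn.
have /andP[h2 _] := bd _ _ _ scd (ltnW ln).
exact: le_lt_trans h1 (lt_le_trans sbc h2).
Qed.

End MeasurableDiagramSum.

(** * Borel dependence of the rank on the endpoints *)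

Section MeasurableRank.
Context {R : realType} (phi : R -> R) (phi_cont : continuous phi).
Implicit Types (a b s t x y z : R) (m : nat) (w : R * R).

Lemma chain_ler s t m a b b' : b <= b' -> chain phi s t m a b -> chain phi s t m a b'.
Proof.
move=> bb'; elim: m a => [//|m IH] a [x [/andP[ax xb] hx H]].
exists x; split => //; first by rewrite ax (le_trans xb).
case: H => [->|[y [/andP[xy yb] hy c]]]; first by left.
by right; exists y; split; rewrite ?xy ?(le_trans yb)//; exact: IH.
Qed.

(** The point [z] may be an endpoint; since [a < b], the open set [{phi > t}] still contains points
    of []a, b[] near [z]. *)
Lemma rat_near a b z t : a < b -> a <= z <= b -> t < phi z ->
  exists q : rat, a < ratr q < b /\ t < phi (ratr q).
Proof.
move=> ab zab tz.
have [r r0 rP] := @cont_dist _ phi phi_cont z (phi z - t) ltac:(by rewrite subr_gt0).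
have [|q] := @rat_in_itvoo R (Num.max a (z - r)) (Num.min b (z + r)).
  by rewrite gt_max !lt_min; lra.
rewrite in_itv /= gt_max lt_min => /andP[/andP[aq zq] /andP[qb qz]].
exists q; rewrite aq qb; split => //.
have /rP : `|z - ratr q| < r by rewrite ltr_distl; lra.
by move=> /(le_lt_trans (ler_norm _)); lra.
Qed.

(* The intermediate point of a chain can be taken rational, as it lies in the
   open set where [phi] exceeds [t]. *)
Lemma chain_rat s t m a b : s < t -> chain phi s t m.+2 a b <->
  exists q : rat, [/\ (exists2 x, a <= x <= ratr q & phi x <= s), t < phi (ratr q)
    & chain phi s t m.+1 (ratr q) b].
Proof.
move=> st; split=> [[x [/andP[ax xb] hx [//|[y [/andP[xy yb] hy c]]]]]|]; last first.
  move=> [q [[x /andP[ax xq] hx] tq c]]; exists x; split => //.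
    have [x' [/andP[qx' x'b] _ _]] := c.
    by rewrite ax (le_trans xq (le_trans qx' x'b)).
  right; exists (ratr q); split => //.
  have [x' [/andP[qx' x'b] _ _]] := c.
  by rewrite xq (le_trans qx' x'b).
have [x' [/andP[yx' x'b] hx' H]] := c.
have yx : x < y.
  by rewrite lt_neqAle xy andbT; apply/eqP => xyE; move: hy; rewrite -xyE; lra.
have [q [/andP[xq qx'] tq]] : exists q : rat, x < ratr q < x' /\ t < phi (ratr q).
  apply: (rat_near (z := y)) => //; first exact: lt_le_trans yx yx'.
  by rewrite xy yx'.
exists q; split => //; first by exists x => //; rewrite ax ltW.
by exists x'; split => //; rewrite (ltW qx').
Qed.

Lemma measurable_fst_mem (A : set R) : measurable A -> measurable [set w : R * R | A w.1].
Proof. by move=> mA; rewrite -[X in measurable X]setTI; exact: measurable_fst. Qed.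

Lemma measurable_snd_mem (A : set R) : measurable A -> measurable [set w : R * R | A w.2].
Proof. by move=> mA; rewrite -[X in measurable X]setTI; exact: measurable_snd. Qed.

Lemma measurable_rat_bigcup (A : rat -> set (R * R)) (B : set (R * R)) :
  (forall q, measurable (A q)) -> (forall w, B w <-> exists q, A q w) -> measurable B.
Proof.
move=> mA BA; rewrite (_ : B = \bigcup_q A q); first exact: bigcupT_measurable_rat.
apply/seteqP; split => w; first by move=> /BA[q]; exists q.
by move=> [q _ Aqw]; apply/BA; exists q.
Qed.

Lemma measurable_between q : measurable [set w : R * R | w.1 < q < w.2].
Proof.
rewrite (_ : [set _ | _] = [set w | `]-oo, q[%classic w.1] `&` [set w | `]q, +oo[%classic w.2]).
  by apply: measurableI; [exact: measurable_fst_mem|exact: measurable_snd_mem].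
by apply/seteqP; split => w /=; rewrite !in_itv /= andbT; [move=> /andP|move=> [-> ->]].
Qed.

Lemma measurable_down (A : set R) : (forall x y, x <= y -> A y -> A x) -> measurable A.
Proof.
move=> Adown; apply: is_interval_measurable => x y _ Ay z /andP[_ zy].
exact: Adown zy Ay.
Qed.

Lemma measurable_up (A : set R) : (forall x y, x <= y -> A x -> A y) -> measurable A.
Proof.
move=> Aup; apply: is_interval_measurable => x y Ax _ z /andP[xz _].
exact: Aup xz Ax.
Qed.

(** A rational [q] between the endpoints splits the condition into one on the left endpoint and one
    on the right. Each is monotone, hence defines an interval, and the union over [q] is
    countable. *)
Lemma measurable_chain s t m : s < t ->
  measurable [set w | w.1 < w.2 /\ chain phi s t m.+1 w.1 w.2].
Proof.
move=> st.
have mlow q : measurable [set a | exists2 x, a <= x <= q & phi x <= s].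
  apply: measurable_down => a a' aa' [x /andP[a'x xq] hx]; exists x => //.
  by rewrite xq (le_trans aa').
have mhigh q : measurable [set b | exists2 x, q <= x <= b & phi x <= s].
  apply: measurable_up => b b' bb' [x /andP[qx xb] hx]; exists x => //.
  by rewrite qx (le_trans xb).
(* A single point has no separating point to split at, so any rational between the endpoints is
   used, with the point on either side of it. *)
case: m => [|m].
  apply: (@measurable_rat_bigcup (fun q => [set w | w.1 < ratr q < w.2] `&`
    ([set w | [set a | exists2 x, a <= x <= ratr q & phi x <= s] w.1] `|`
     [set w | [set b | exists2 x, ratr q <= x <= b & phi x <= s] w.2]))).
    move=> q; apply: measurableI; first exact: measurable_between.
    by apply: measurableU; [exact: measurable_fst_mem|exact: measurable_snd_mem].
  move=> w /=; split => [[w12 [x [/andP[ax xb] hx _]]]|].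
    have [q] := rat_in_itvoo w12; rewrite in_itv /= => wq.
    exists q; split => //; have [xq|qx] := leP x (ratr q).
      by left; exists x; rewrite ?ax.
    by right; exists x; rewrite ?(ltW qx).
  move=> [q [/andP[aq qb] [[x /andP[x1 x2] hx]|[x /andP[x1 x2] hx]]]].
    split; first exact: lt_trans aq qb.
    by exists x; split; rewrite ?x1 ?(le_trans x2 (ltW qb))//; left.
  split; first exact: lt_trans aq qb.
  by exists x; split; rewrite ?x2 ?(le_trans (ltW aq))//; left.
have lt_meas : measurable [set w : R * R | w.1 < w.2].
  apply: (@measurable_rat_bigcup (fun q => [set w | w.1 < ratr q < w.2])).
    by move=> q; exact: measurable_between.
  move=> w /=; split => [/rat_in_itvoo[q]|[q /andP[]]]; last exact: lt_trans.
  by rewrite in_itv /=; exists q.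
rewrite (_ : [set _ | _] = [set w : R * R | w.1 < w.2] `&`
    [set w | chain phi s t m.+2 w.1 w.2]); last by [].
apply: measurableI => //.
pose A q := if t < phi (ratr q) then
  [set w | [set a | exists2 x, a <= x <= ratr q & phi x <= s] w.1] `&`
  [set w | [set b | chain phi s t m.+1 (ratr q) b] w.2] else set0.
apply: (@measurable_rat_bigcup A).
  move=> q; rewrite /A; case: ifP => // _.
  apply: measurableI; first exact: measurable_fst_mem.
  by apply: measurable_snd_mem; apply: measurable_up => b b' bb'; exact: chain_ler.
move=> w; split => [/(chain_rat _ _ _ st)[q [h1 h2 h3]]|[q]].
  by exists q; rewrite /A h2; split.
rewrite /A; case: ifP => // tq [h1 h2].
by apply/(chain_rat _ _ _ st); exists q.
Qed.

(** Extended by zero to all pairs, so as to be defined on the whole plane; the endpoints of an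
    increasing function satisfy [w.1 < w.2]. *)
Definition prank_pair w s t : nat := if w.1 < w.2 then prank phi w.1 w.2 s t else 0%N.

Lemma measurable_prank_pair s t : s < t ->
  measurable_fun setT (fun w => (prank_pair w s t)%:R : R).
Proof.
move=> st; apply: measurable_natr_of_lt => m.
have mmax : measurable [set w | w.1 < w.2 /\ exists2 z, w.1 <= z <= w.2 & t < phi z].
  apply: (@measurable_rat_bigcup (fun q => if t < phi (ratr q) then
      [set w | w.1 < ratr q < w.2] else set0)).
    by move=> q; case: ifP => // _; exact: measurable_between.
  move=> w /=; split => [[w12 [z zab tz]]|[q]].
    by have [q [wq tq]] := rat_near w12 zab tz; exists q; rewrite tq.
  case: ifP => // tq /andP[wq qw]; split; first exact: lt_trans wq qw.
  by exists (ratr q); rewrite ?ltW.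
rewrite (_ : [set _ | _] =
  [set w | w.1 < w.2 /\ exists2 z, w.1 <= z <= w.2 & t < phi z] `&`
  [set w | w.1 < w.2 /\ chain phi s t m.+1 w.1 w.2]).
  by apply: measurableI => //; exact: measurable_chain.
apply/seteqP; split => w /=; rewrite /prank_pair /prank.
  case: ifP => // w12; case: asboolP => // H.
  by move=> /(ncomp_geP phi_cont _ _ _ st)/comp_ge_chain.
move=> [[w12 H] [_ c]]; rewrite w12 asboolT//; apply/(ncomp_geP phi_cont) => //.
exact/comp_ge_chain.
Qed.

Lemma prank_pair_rank_function (M : R) w : (forall x, `|phi x| < M) ->
  rank_function M (prank_pair w).
Proof.
move=> phiM; rewrite /prank_pair; case: (w.1 < w.2); split => //.
- exact: prank_alternating.
- exact: prank_right_contl.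
- exact: prank_right_contr.
- by move=> s t; exact: prank_out.
- by move=> s t _; exact: nearW.
- by move=> s t _; exact: nearW.
Qed.

End MeasurableRank.

(** * The signature *)

Section Evaluation.
Context {R : realType} (X : topologicalType) (Gamma : set (cont_space X R))
  (Gamma0 : Gamma !=set0).

Lemma cont_space_eval_continuous (x : X) : continuous (fun g : cont_space X R => g x).
Proof.
have eval_unif : continuous (fun f : {uniform X -> R} => f x).
  move=> f U /nbhs_ballP[e /= e0 eU].
  apply/uniform_nbhs; exists [set xy | ball xy.1 e xy.2]; split.
    exact: entourage_ball (PosNum e0).
  by move=> h hP; apply: eU; exact: hP.
move=> g; apply: (@continuous_comp _ _ _
  (fun g : cont_space X R => (g : {uniform X -> R})) (fun f : {uniform X -> R} => f x)).
  exact: initial_continuous.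
exact: eval_unif.
Qed.

(** Uniform convergence implies pointwise convergence, so evaluation is continuous and pulls open
    intervals back to open sets. *)
Lemma measurable_borel_subspace_eval (x : X) :
  measurable_fun setT (fun g : borel_subspace Gamma0 => (val g : cont_space X R) x).
Proof.
apply: (measurability _ (RGenOpens.measurableE R)).
move=> _ [_ [a [b ->] <-]]; rewrite setTI; apply: sub_sigma_algebra.
apply: open_comp; last exact: interval_open.
move=> g _; apply: (@continuous_comp _ _ _ (val : borel_subspace Gamma0 -> cont_space X R)
  (fun g : cont_space X R => g x)); last exact: cont_space_eval_continuous.
exact: initial_continuous.
Qed.

End Evaluation.

Section WeightedKernel.
Context {R : realType} (n : nat) (eps p : R).
Hypothesis p_gt1 : 1 < p.

Lemma powR_pos_continuous : continuous (fun u : R => Num.max u 0 `^ p).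
Proof.
have p0 : 0 < p := lt_trans ltr01 p_gt1.
have pN0 : p != 0 by rewrite gt_eqF.
move=> u; have [u0|u0] := ltP 0 u.
  have cu : {for u, continuous (fun u : R => u `^ p)}.
    apply/differentiable_continuous/derivable1_diffP.
    by apply: derivable_powR; rewrite in_itv /= u0.
  rewrite /continuous_at (max_idPl (ltW u0)); apply: cvg_trans cu.
  apply: near_eq_cvg; near=> v; rewrite max_l//; apply: ltW.
  by near: v; exact: lt_nbhsr.
(* For [u <= 0] the value is zero; the limit of the power at zero and its monotonicity bound a whole
   neighbourhood. *)
apply/cvgrPdist_le => e e0; rewrite (max_idPr u0) powR0//.
have /cvgrPdist_le/(_ _ e0) := powR_cvg0 p0.
move=> [c /= c0 cP].
have c20 : 0 < c / 2 by rewrite divr_gt0.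
have ce : (c / 2) `^ p <= e.
  have := cP (c / 2); rewrite /= sub0r normrN gtr0_norm// => /(_ ltac:(lra) c20).
  by rewrite sub0r normrN ger0_norm ?powR_ge0.
apply/nbhs_ballP; exists (c / 2) => //= v.
rewrite /ball /= ltr_distl => /andP[vc _].
rewrite sub0r normrN ger0_norm ?powR_ge0//; apply: le_trans ce.
apply: ge0_ler_powR; rewrite ?nnegrE ?le_max ?lexx ?orbT ?(ltW p0)//; first exact: ltW.
by rewrite ge_max (ltW c20) andbT; lra.
Unshelve. all: by end_near. Qed.

Lemma weight_powR_continuous : continuous (fun x : R * R => weight eps x `^ p).
Proof.
move=> x; apply: (@continuous_comp _ _ _ (fun x : R * R => x.2 - x.1 - eps)
  (fun u : R => Num.max u 0 `^ p)); last exact: powR_pos_continuous.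
apply: (@cvgB _ R^o); last exact: cvg_cst.
by apply: (@cvgB _ R^o); [exact: cvg_snd|exact: cvg_fst].
Qed.

Lemma weight_powR_eq0 x : x.2 - x.1 <= eps -> weight eps x `^ p = 0.
Proof.
move=> xe; rewrite /weight (max_idPr _) ?powR0//; last by lra.
by rewrite gt_eqF// (lt_trans ltr01 p_gt1).
Qed.

Lemma kernel_continuous (k : R * R -> 'rV[R]_n -> R) (t : 'rV[R]_n) :
  is_kernel k -> continuous (k ^~ t).
Proof.
case=> _ _ [L L0 kL] _ x; apply/cvgrPdist_lt => e e0.
apply/(@nbhs_normP R (R * R)%type); exists (e / L) => /=; first by rewrite divr_gt0.
move=> y /= xy.
have : (`|k x t - k y t|%:E <= (L * `|x - y|)%:E)%E.
  by apply: le_trans (kL x y); apply: ereal_sup_ubound; exists t.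
rewrite lee_fin => /le_lt_trans; apply.
by rewrite mulrC -ltr_pdivlMr.
Qed.

End WeightedKernel.

(** Subtracting the floor moves every point into [[0, 1]], where the continuous function has a
    maximal absolute value. *)
Lemma periodic_bounded {R : realType} (phi : R -> R) : continuous phi ->
  (forall x, phi (x + 1) = phi x) -> exists M, forall x, `|phi x| < M.
Proof.
move=> cphi per.
have perN (m : nat) x : phi (x + m%:R) = phi x.
  by elim: m => [|m IH]; rewrite ?addr0// -natr1 addrA per.
have perZ (z : int) x : phi (x + z%:~R) = phi x.
  by case: z => m; [exact: perN|rewrite NegzE mulrNz -(perN m.+1) subrK].
have nphi : {within `[0, 1], continuous (fun x => `|phi x|)}.
  apply: continuous_subspaceT => x; apply: continuous_comp; first exact: cphi.
  exact: norm_continuous.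
have [c _ cmax] := EVT_max ler01 nphi.
exists (`|phi c| + 1) => x; rewrite -(perZ (- Num.floor x)) mulrNz.
apply: le_lt_trans (cmax _ _) _; last by rewrite ltrDl.
have /andP[h1 h2] := floor_itv x.
by rewrite in_itv /=; move: h2; rewrite intrD; lra.
Qed.

(** The four ranks of a rectangle are all taken at pairs [s < t], the range in which [pers_rankE]
    holds. *)
Lemma is_diagram_eq {R : realType} (r r' : R -> R -> nat) :
  (forall s t, s < t -> r s t = r' s t) -> is_diagram r = is_diagram r'.
Proof.
move=> rr'; apply/funext => m; apply/propext; split => -[h1 h2 h3]; split => //.
  move=> a b c d ab bc cd H; rewrite h3// !rr'//; lra.
move=> a b c d ab bc cd H; rewrite h3// !rr'//; lra.
Qed.

(** * The functional as a Borel function of the endpoints *)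

Section EndpointFunctional.
Context {R : realType} (n : nat) (eps p : R) (k : R * R -> 'rV[R]_n -> R).
Hypotheses (eps_gt0 : 0 < eps) (p_gt1 : 1 < p) (k_kernel : is_kernel k).
Variables (phi : R -> R) (phi_cont : continuous phi) (M : R).
Hypothesis phiM : forall x, `|phi x| < M.

Definition endpoint_rho (t : 'rV[R]_n) (w : R * R) : R :=
  let den := dsum (the_diagram (prank_pair phi w)) (fun x => weight eps x `^ p) in
  if 0 < den
  then dsum (the_diagram (prank_pair phi w)) (fun x => weight eps x `^ p * k x t) / den
  else 0.

Lemma measurable_endpoint_rho t : measurable_fun setT (endpoint_rho t).
Proof.
have mden : measurable_fun setT (fun w =>
    dsum (the_diagram (prank_pair phi w)) (fun x => weight eps x `^ p)).
  apply: (measurable_dsum (M := M) (eps := eps)) => //.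
  - by move=> w; exact: prank_pair_rank_function.
  - by move=> s u; exact: measurable_prank_pair.
  - exact: weight_powR_continuous.
  - by move=> x; exact: weight_powR_eq0.
have mnum : measurable_fun setT (fun w =>
    dsum (the_diagram (prank_pair phi w)) (fun x => weight eps x `^ p * k x t)).
  apply: (measurable_dsum (M := M) (eps := eps)) => //.
  - by move=> w; exact: prank_pair_rank_function.
  - by move=> s u; exact: measurable_prank_pair.
  - move=> x; apply: cvgM; first exact: weight_powR_continuous.
    exact: kernel_continuous.
  - by move=> x xe; rewrite weight_powR_eq0 ?mul0r.
(* Where the denominator is positive, division is multiplication by its power of exponent [- 1],
   which is measurable. *)
rewrite (_ : endpoint_rho t = fun w =>
  let den := dsum (the_diagram (prank_pair phi w)) (fun x => weight eps x `^ p) in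
  if 0 < den
  then dsum (the_diagram (prank_pair phi w)) (fun x => weight eps x `^ p * k x t) *
    den `^ (- 1)
  else 0); last first.
  apply/funext => w; rewrite /endpoint_rho /=; case: ifP => // /ltW den0.
  by rewrite powR_inv1.
apply: measurable_fun_ifT; last exact: measurable_cst.
  by apply: measurable_fun_ltr => //; exact: measurable_cst.
apply: measurable_funM => //.
exact: (measurableT_comp (measurable_powR _)).
Qed.

Lemma rho_bar_endpoint (K : fieldType) (a b : R) (ab : a < b)
    (g : segment a b -> R) (t : 'rV[R]_n) :
  continuous g -> (forall x y : segment a b, val x < val y -> g x < g y) ->
  rho_bar K eps p k (phi \o g) t =
  endpoint_rho t (g (segment_left (ltW ab)), g (segment_right (ltW ab))).
Proof.
move=> g_cont g_incr.
have glr : g (segment_left (ltW ab)) < g (segment_right (ltW ab)) by apply: g_incr.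
have diagE : is_offdiagonal_diagram K (phi \o g) =
    is_diagram (prank_pair phi
      (g (segment_left (ltW ab)), g (segment_right (ltW ab)))).
  apply: (@is_diagram_eq _ (pers_rank K (phi \o g))) => s u su.
  by rewrite /prank_pair /= glr; exact: pers_rankE phiM su.
by rewrite /rho_bar /diagram_sum /diagram diagE.
Qed.

End EndpointFunctional.

(** No sign or integrability of [f] is assumed: the change of variables for nonnegative functions is
    applied to its positive and negative parts. *)
Lemma integral_pushforward_eq {R : realType} (d1 d2 d : measure_display)
    (Omega1 : measurableType d1) (Omega2 : measurableType d2) (Y : measurableType d)
    (P1 : {measure set Omega1 -> \bar R}) (P2 : {measure set Omega2 -> \bar R})
    (X1 : Omega1 -> Y) (X2 : Omega2 -> Y) (f : Y -> \bar R) :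
  measurable_fun setT X1 -> measurable_fun setT X2 -> measurable_fun setT f ->
  (forall B, measurable B -> P1 (X1 @^-1` B) = P2 (X2 @^-1` B)) ->
  (\int[P1]_w f (X1 w) = \int[P2]_w f (X2 w))%E.
Proof.
move=> mX1 mX2 mf PX.
have E (h : Y -> \bar R) : measurable_fun setT h -> (forall y, 0 <= h y)%E ->
    (\int[P1]_w h (X1 w) = \int[P2]_w h (X2 w))%E.
  move=> mh h0.
  have := ge0_integral_pushforward mX1 P1 (@measurableT _ Y) mh (fun y _ => h0 y).
  have := ge0_integral_pushforward mX2 P2 (@measurableT _ Y) mh (fun y _ => h0 y).
  rewrite !preimage_setT => <- <-; apply: eq_measure_integral => A mA _.
  exact: PX.
have posE (W : Type) (X : W -> Y) : ((fun w => f (X w))^\+ = f^\+ \o X)%E.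
  by apply/funext => w; rewrite /= !funeposE.
have negE (W : Type) (X : W -> Y) : ((fun w => f (X w))^\- = f^\- \o X)%E.
  by apply/funext => w; rewrite /= !funenegE.
rewrite integralE [RHS]integralE (posE _ X1) (posE _ X2) (negE _ X1) (negE _ X2).
congr (_ - _)%E.
  exact: E (measurable_funepos mf) (funepos_ge0 f).
exact: E (measurable_funeneg mf) (funeneg_ge0 f).
Qed.

Theorem propositionB1 (R : realType) (K : fieldType) (n : nat)
    (eps p : R) (eps_gt0 : 0 < eps) (p_gt1 : 1 < p)
    (k : R * R -> 'rV[R]_n -> R) (k_kernel : is_kernel k)
    (phi : R -> R) (phi_cont : continuous phi)
    (phi_periodic : forall x, phi (x + 1) = phi x)
    (T : R) (T_gt0 : 0 < T)
    (Gamma : set (cont_space (segment 0 T) R))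
    (Gamma_closed : closed Gamma)
    (Gamma_incr : forall g, Gamma g ->
      forall s t : segment 0 T, val s < val t -> g s < g t)
    (Gamma0 : Gamma !=set0)
    (mu1 mu2 : probability (borel_subspace Gamma0) R)
    (d1 d2 : measure_display)
    (Omega1 : measurableType d1) (Omega2 : measurableType d2)
    (P1 : probability Omega1 R) (P2 : probability Omega2 R)
    (gamma1 : {RV P1 >-> borel_subspace Gamma0})
    (gamma2 : {RV P2 >-> borel_subspace Gamma0})
    (gamma1_law : forall A, measurable A -> distribution P1 gamma1 A = mu1 A)
    (gamma2_law : forall A, measurable A -> distribution P2 gamma2 A = mu2 A) :
  let delta (g : borel_subspace Gamma0) : R * R :=
    (val g (segment_left (ltW T_gt0)), val g (segment_right (ltW T_gt0))) in
  (forall B : set (R * R), measurable B ->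
    pushforward mu1 delta B = pushforward mu2 delta B) ->
  signature K eps p k P1 (fun w => phi \o val (gamma1 w)) =
  signature K eps p k P2 (fun w => phi \o val (gamma2 w)).
Proof.
move=> delta delta_law.
have [M phiM] := periodic_bounded phi_cont phi_periodic.
have mdelta : measurable_fun setT delta.
  by apply: measurable_fun_pair; exact: measurable_borel_subspace_eval.
have rhoE (g : borel_subspace Gamma0) t :
    rho_bar K eps p k (phi \o val g) t = endpoint_rho eps p k phi t (delta g).
  apply: (rho_bar_endpoint _ _ _ phiM).
    exact: cts_fun.
  by apply: Gamma_incr; case: g => g /= /set_mem.
apply/funext => t; rewrite /signature unlock.
under eq_integral do rewrite rhoE.
under [RHS]eq_integral do rewrite rhoE.
apply: (@integral_pushforward_eq R _ _ _ Omega1 Omega2 _ P1 P2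
  (delta \o gamma1) (delta \o gamma2) (EFin \o endpoint_rho eps p k phi t)).
- exact: measurableT_comp.
- exact: measurableT_comp.
- by apply/measurable_EFinP; exact: (measurable_endpoint_rho _ _ _ _ phiM).
(* The law of the endpoints under [P1] is the push-forward of [mu1] by [delta], and likewise for
   [P2] and [mu2]. *)
- move=> B mB; have mdB : measurable (delta @^-1` B).
    by rewrite -[X in measurable X]setTI; exact: mdelta.
  have := delta_law B mB; rewrite /pushforward -gamma1_law// -gamma2_law//.
Qed.
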